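(* In the two-sample setting and under the model and Assumptions 1–4 of the context, let $i\ne j\in\{1,2\}$ and $n_1,n_2\ge 4$. Then $E_0$, $E_i$, $E_{ij}$ are unbiased estimators of $\|{\boldsymbol\mu}_1-{\boldsymbol\mu}_2\|^2/p$, $\mathrm{tr}({\boldsymbol\Sigma}_i^2)/p^2$ and $\mathrm{tr}({\boldsymbol\Sigma}_1{\boldsymbol\Sigma}_2)/p^2$ respectively, and, assuming moreover that $\|{\boldsymbol\mu}_1-{\boldsymbol\mu}_2\|^2/p$ is bounded away from $0$, the following bounds hold uniformly in $p$: \[ \mathrm{Var}\Big(\frac{E_0}{\|{\boldsymbol\mu}_1-{\boldsymbol\mu}_2\|^2/p}\Big)=O\Big(\frac1{n_i}+\frac1{n_j}\Big),\qquad \mathrm{Var}\Big(\frac{E_i}{\mathrm{tr}({\boldsymbol\Sigma}_i^2)/p^2}\Big)=O\Big(\frac1{n_i}\Big), \] \[ \mathrm{Var}\Big(\frac{E_{ij}}{\mathrm{tr}({\boldsymbol\Sigma}_i{\boldsymbol\Sigma}_j)/p^2}\Big)=O\Big(\frac1{n_i}+\frac1{n_j}\Big),\qquad \mathrm{Cov}\Big(\frac{E_i}{\mathrm{tr}({\boldsymbol\Sigma}_i^2)/p^2},\frac{E_{ij}}{\mathrm{tr}({\boldsymbol\Sigma}_i{\boldsymbol\Sigma}_j)/p^2}\Big)=O\Big(\frac1{n_i}\Big). \] In particular each ratio converges in probability to $1$ as $n_1,n_2\to\infty$ (with $p$ fixed or $p\to\infty$).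
   Context: Two-sample setting: for $i=1,2$, ${\bf x}_{i1},\dots,{\bf x}_{in_i}$ are i.i.d. random vectors in $\mathbb{R}^p$ with mean ${\boldsymbol\mu}_i$ and positive definite covariance ${\boldsymbol\Sigma}_i$; the two samples are independent. Model: ${\bf x}_{ik}={\boldsymbol\mu}_i+{\boldsymbol\Lambda}_i{\bf y}_{ik}$, where ${\bf y}_{ik}\in\mathbb{R}^p$ has i.i.d. components with mean $0$ and variance $1$, and ${\boldsymbol\Lambda}_i$ is a deterministic $p\times p$ matrix with ${\boldsymbol\Lambda}_i{\boldsymbol\Lambda}_i'={\boldsymbol\Sigma}_i$. All parameters may depend on $p$. Assumption 1: $\mathrm{E}(y_{iks}^4)=\gamma<\infty$. Assumption 2: $\mathrm{tr}({\boldsymbol\Sigma}_i)/p=O(1)$ as $p\to\infty$, $i=1,2$. Assumption 3: ${\boldsymbol\mu}_i'{\boldsymbol\Sigma}_k{\boldsymbol\mu}_j/p=O(1)$ as $p\to\infty$ for all $i,j,k\in\{1,2\}$. Assumption 4: $\mathrm{tr}({\boldsymbol\Sigma}_i^a\odot{\boldsymbol\Sigma}_j^b)/\mathrm{tr}({\boldsymbol\Sigma}_i^a\otimes{\boldsymbol\Sigma}_j^b)\to0$ as $p\to\infty$ for $a,b\in\{1,2,3\}$, $a+b\le4$, $i,j\in\{1,2\}$ ($\odot$ Hadamard product, $\otimes$ Kronecker product). Estimators: $U_{n_i}=\frac{1}{p\,n_i(n_i-1)}\sum_{k\ne r}{\bf x}_{ik}'{\bf x}_{ir}$, $U_{n_1n_2}=\frac{1}{p\,n_1n_2}\sum_{k=1}^{n_1}\sum_{l=1}^{n_2}{\bf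 x}_{1k}'{\bf x}_{2l}$, $E_0=U_{n_1}+U_{n_2}-2U_{n_1n_2}$. With ${\bf D}_{ikr}={\bf x}_{ik}-{\bf x}_{ir}$ ($k\ne r$), $\eta(n_i)=n_i(n_i-1)(n_i-2)(n_i-3)$ and $\eta(n_in_j)=n_in_j(n_i-1)(n_j-1)$: \[ E_i=\frac{1}{4\eta(n_i)p^2}\sum_{(k,r,k',r')}({\bf D}_{ikr}'{\bf D}_{ik'r'})^2,\qquad E_{ij}=\frac{1}{4\eta(n_in_j)p^2}\sum_{k\ne r}\sum_{l\ne s}({\bf D}_{ikr}'{\bf D}_{jls})^2, \] where the first sum is over ordered quadruples of pairwise distinct indices in $\{1,\dots,n_i\}$, and in the second $k\ne r$ range over $\{1,\dots,n_i\}$, $l\ne s$ over $\{1,\dots,n_j\}$. *)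

(* Defs.v *)
From HB Require Import structures.
From mathcomp Require Import all_boot all_order all_algebra.
From mathcomp Require Import all_classical all_reals all_analysis.
From mathcomp.real_closed Require Import mxtens.

Set Implicit Arguments.
Unset Strict Implicit.
Unset Printing Implicit Defensive.

Import Order.TTheory GRing.Theory Num.Theory.
Local Open Scope ring_scope.
Local Open Scope classical_set_scope.

(* the two samples are indexed by 'I_2 : sample "1" is s1, sample "2" is s2 *)
Definition s1 : 'I_2 := @Ordinal 2 0 isT.
Definition s2 : 'I_2 := @Ordinal 2 1 isT.

Definition hadamard {R : pzRingType} {p : nat} (A B : 'M[R]_p) : 'M[R]_p :=
  \matrix_(s, t) (A s t * B s t).

Definition dotv {R : pzRingType} {p : nat} (u v : 'cV[R]_p) : R :=
  \sum_(s < p) u s 0 * v s 0.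

Definition bform {R : pzRingType} {p : nat} (u : 'cV[R]_p) (A : 'M[R]_p) (v : 'cV[R]_p) : R :=
  (u^T *m A *m v) 0 0.

Definition posdef {R : numDomainType} {p : nat} (A : 'M[R]_p) : Prop :=
  A^T = A /\ forall v : 'cV[R]_p, v != 0 -> 0 < bform v A v.

Definition Sig {R : pzRingType} (Lam : 'I_2 -> forall p : nat, 'M[R]_p)
  (i : 'I_2) (p : nat) : 'M[R]_p := Lam i p *m (Lam i p)^T.

Definition bigO1 {R : realType} (f : nat -> R) : Prop :=
  exists C : R, exists p0 : nat, forall p, (p0 <= p)%N -> `|f p| <= C.

(* mutual independence of a finite family of real random variables:
   product rule for every choice of Borel sets (taking B i = setT drops
   index i, so this covers every finite subfamily) *)
Definition mutual_indep {d} {T : measurableType d} {R : realType}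
  (P : probability T R) {I : finType} (X : I -> T -> R) : Prop :=
  forall B : I -> set R, (forall i, measurable (B i)) ->
    P (\bigcap_(i in [set: I]) (X i @^-1` B i)) =
    (\prod_(i : I) P (X i @^-1` B i))%E.

Definition yidx (n : 'I_2 -> nat) (p : nat) : finType :=
  {i : 'I_2 & ('I_(n i) * 'I_p)%type}.

Section Model.
Context {d} {T : measurableType d} {R : realType} (P : probability T R).
Context (p : nat) (n : 'I_2 -> nat).
Context (mu : 'I_2 -> 'cV[R]_p) (Lam : 'I_2 -> 'M[R]_p).
Context (y : forall i : 'I_2, 'I_(n i) -> 'I_p -> {RV P >-> R}).

Definition yflat (a : yidx n p) : T -> R :=
  @y (tag a) (tagged a).1 (tagged a).2.

Definition model_hyp (gamma : R) : Prop :=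
  [/\ mutual_indep P yflat,
      (forall i k s k' s', distribution P (@y i k s) = distribution P (@y i k' s')),
      (forall i k s, ('E_P[@y i k s] = 0)%E),
      (forall i k s, ('E_P[(fun w => (@y i k s w ^+ 2)%R)] = 1)%E) &
      (forall i k s, ('E_P[(fun w => (@y i k s w ^+ 4)%R)] = gamma%:E)%E)].

Definition xv (i : 'I_2) (k : 'I_(n i)) (w : T) : 'cV[R]_p :=
  mu i + Lam i *m \col_(s < p) @y i k s w.

Definition Dv (i : 'I_2) (k r : 'I_(n i)) (w : T) : 'cV[R]_p :=
  @xv i k w - @xv i r w.

Definition Un (i : 'I_2) (w : T) : R :=
  (p%:R * (n i)%:R * ((n i)%:R - 1))^-1 *
  \sum_(k < n i) \sum_(r < n i | k != r) dotv (@xv i k w) (@xv i r w).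

Definition Un12 (w : T) : R :=
  (p%:R * (n s1)%:R * (n s2)%:R)^-1 *
  \sum_(k < n s1) \sum_(l < n s2) dotv (@xv s1 k w) (@xv s2 l w).

Definition E0 (w : T) : R := Un s1 w + Un s2 w - 2 * Un12 w.

Definition eta1 (m : nat) : R := (m * (m - 1) * (m - 2) * (m - 3))%:R.
Definition eta2 (m m' : nat) : R := (m * m' * (m - 1) * (m' - 1))%:R.

Definition Ei (i : 'I_2) (w : T) : R :=
  (4 * eta1 (n i) * p%:R ^+ 2)^-1 *
  \sum_(k < n i) \sum_(r < n i) \sum_(k' < n i) \sum_(r' < n i
         | uniq [:: k; r; k'; r'])
     (dotv (@Dv i k r w) (@Dv i k' r' w)) ^+ 2.

Definition Eij (i j : 'I_2) (w : T) : R :=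
  (4 * eta2 (n i) (n j) * p%:R ^+ 2)^-1 *
  \sum_(k < n i) \sum_(r < n i | k != r) \sum_(l < n j) \sum_(s < n j | l != s)
     (dotv (@Dv i k r w) (@Dv j l s w)) ^+ 2.

End Model.

(* Main.v *)
Require Import Defs.
From HB Require Import structures.
From mathcomp Require Import all_boot all_order all_algebra.
From mathcomp Require Import all_classical all_reals all_analysis.
From mathcomp Require Import measurable_realfun ring lra zify.
From mathcomp.real_closed Require Import mxtens.

Import Order.TTheory GRing.Theory Num.Theory numFieldNormedType.Exports.
Local Open Scope ring_scope.
Local Open Scope classical_set_scope.

(* The centred kernels of all the estimators are polynomials, of degree at most 2
   in each coordinate y_iks, that depend on at most four of the vectors y_ik. By
   independence, kernels with no y_ik in common are uncorrelated; a proportion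
   O(1/n) of the pairs of kernels have one in common, so the variances and the
   covariance are O(1/n) as soon as the normalised kernels are bounded in L^2.
   For E_i and E_ij the kernel is the square of a combination of bilinear forms
   y'Az with A = Lambda_i' Lambda_j and |A|_F^2 = tr(Sigma_i Sigma_j), so all that
   is needed is E (y'Az)^4 <= (9 + gamma)^2 |A|_F^4. This follows by applying twice
   the bound of linear_form_moment4, first with constant coefficients and then
   with the coefficients Az. For E_0 second moments suffice, and Assumptions 2
   and 3 bound them. *)

(** * Expectation of a product of independent variables *)

(** Independence is given only as a product rule for events, so the factorisation of expectations
    has to be built up from indicators, and it must not cost moments above the fourth. What matters
    for this is the degree in each single coordinate, not the total degree: the fourth power of a
    bilinear form in two distinct vectors, like the product of two squared kernels that share
    vectors, has degree 4 in each coordinate. Polynomials with a degree bound per variable therefore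
    settle integrability and independence together. Tuples with repeated indices would spoil
    bilinearity and are excluded by a predicate, but counting is done over all tuples, of which the
    admissible ones are a proportion of at least 1/11 (1/2 for [E0]). Shared vectors are counted
    along the tuples of the first of two statistics only; this is why the covariance of [Ei] and
    [Eij] is governed by n_i alone. Uniformity in p comes from dividing each squared kernel by its
    exact mean, whose square matches the bound on the fourth moment. Consistency is Chebyshev's
    inequality. *)

Section product_rule.
Import HBNNSimple.
Context {d : measure_display} {T : measurableType d} {R : realType}.
Context (P : probability T R).

(** Linearity carries the identity from indicators to simple functions, and monotone convergence to
    nonnegative measurable [f]. In use, [G] is the product of the other factors and [c] its
    expectation; a real [c] commutes with the limit. *)
Lemma ge0_integral_extend_indic (X G : T -> R) (c : R) (f : R -> R) :
  measurable_fun setT X -> measurable_fun setT G -> (forall w, 0 <= G w) ->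
  0 <= c ->
  (forall B, measurable B ->
     (\int[P]_w (\1_B (X w) * G w)%:E = c%:E * P (X @^-1` B))%E) ->
  measurable_fun setT f -> (forall x, 0 <= f x) ->
  (\int[P]_w (f (X w) * G w)%:E = c%:E * \int[P]_w (f (X w))%:E)%E.
Proof.
move=> mX mG G0 c0 H mf f0.
have mEf : measurable_fun (T:=R) (U:=\bar R) setT (fun x => (f x)%:E) by apply/measurable_EFinP.
have Ef0 : forall x : R, setT x -> (0 <= ((f x)%:E))%E.
  by move=> x _; rewrite lee_fin.
pose g := @nnsfun_approx _ _ R setT measurableT (EFin \o f) mEf.
have gcvg x : EFin (g n x) @[n --> \oo] --> (f x)%:E.
  exact: (@cvg_nnsfun_approx _ _ R setT measurableT _ mEf Ef0 x).
have gnd x : {homo (fun n => g n x) : n m / (n <= m)%N >-> n <= m}.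
  by move=> n m nm; have /lefP := nd_nnsfun_approx measurableT mEf nm; apply.
have mgX n : measurable_fun setT (fun w => g n (X w)).
  by apply: measurableT_comp.
have simple n : (\int[P]_w (g n (X w) * G w)%:E = c%:E * \int[P]_w (g n (X w))%:E)%E.
  have fin : finite_set (range (g n)) by [].
  have mi r : measurable (g n @^-1` [set r]) by exact: measurable_funPTI.
  have miX r : measurable_fun setT (fun w => \1_(g n @^-1` [set r]) (X w) : R).
    by apply: measurableT_comp => //; exact: measurable_indic.
  have pos r x : (0 <= r * \1_(g n @^-1` [set r]) x).
    rewrite indicE; case: (boolP (x \in _)) => [|_]; last by rewrite mulr0.
    by rewrite inE /= => <-; rewrite mulr1.
  transitivity (\int[P]_w (\sum_(r \in range (g n)) (r * \1_(g n @^-1` [set r]) (X w) * G w)%:E))%E.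
    apply: eq_integral => w _; rewrite fsumEFin//; congr (_%:E).
    rewrite {1}(fimfunE (g n)) !fsbig_finite//= mulr_suml//.
  have -> : (\int[P]_w (g n (X w))%:E = \int[P]_w (\sum_(r \in range (g n)) (r * \1_(g n @^-1` [set r]) (X w))%:E))%E.
    by apply: eq_integral => w _; rewrite fsumEFin// {1}(fimfunE (g n)).
  rewrite !ge0_integral_fsum//; last 4 first.
  - by move=> r; apply/measurable_EFinP; apply: measurable_funM.
  - by move=> r w _; rewrite lee_fin.
  - move=> r; apply/measurable_EFinP; apply: measurable_funM => //.
    by apply: measurable_funM.
  - by move=> r w _; rewrite lee_fin mulr_ge0.
  rewrite ge0_mule_fsumr; last first.
    by move=> r; apply: integral_ge0 => w _; rewrite lee_fin.
  apply: eq_fsbigr => r; rewrite inE /= => -[x _ xr].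
  have r0 : 0 <= r by rewrite -xr.
  transitivity (r%:E * \int[P]_w (\1_(g n @^-1` [set r]) (X w) * G w)%:E)%E.
    rewrite -ge0_integralZl_EFin//.
    - by apply: eq_integral => w _; rewrite -EFinM mulrA.
    - by move=> w _; rewrite lee_fin mulr_ge0.
    - by apply/measurable_EFinP; apply: measurable_funM.
  rewrite H// muleCA; congr (_ * _)%E.
  under eq_integral do rewrite EFinM.
  rewrite ge0_integralZl_EFin//; last first.
    by apply/measurable_EFinP.
  congr (_ * _)%E.
  rewrite -[in LHS](setIT (X @^-1` _)) -(integral_indic P measurableT)//.
  by rewrite -[X in measurable X]setTI; apply: mX.
have -> : (\int[P]_w (f (X w) * G w)%:E = \int[P]_w limn (fun n => (g n (X w) * G w)%:E))%E.
  apply: eq_integral => w _; apply/esym/cvg_lim => //.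
  rewrite EFinM; under [X in X @ _ --> _]eq_fun do rewrite EFinM.
  by apply: cvgeZr => //; exact: gcvg.
have -> : (\int[P]_w (f (X w))%:E = \int[P]_w limn (fun n => (g n (X w))%:E))%E.
  by apply: eq_integral => w _; apply/esym/cvg_lim => //; exact: gcvg.
rewrite !monotone_convergence//; last 6 first.
- by move=> n; apply/measurable_EFinP.
- by move=> n w _; rewrite lee_fin.
- by move=> w _ n m nm; rewrite lee_fin; exact: gnd.
- by move=> n; apply/measurable_EFinP; exact: measurable_funM.
- by move=> n w _; rewrite lee_fin mulr_ge0.
- by move=> w _ n m nm; rewrite lee_fin ler_wpM2r//; exact: gnd.
have -> : (fun n => \int[P]_w (g n (X w) * G w)%:E)%E = (fun n => c%:E * \int[P]_w (g n (X w))%:E)%E.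
  by apply/funext => n; exact: simple.
rewrite limeMl//; apply: ereal_nondecreasing_is_cvgn => n m nm.
apply: ge0_le_integral => //.
- by move=> w _; rewrite lee_fin.
- by apply/measurable_EFinP.
- by apply/measurable_EFinP.
- by move=> w _; rewrite lee_fin; exact: gnd.
Qed.

Context {I : finType} (Y : I -> {RV P >-> R}).
Hypothesis indep : mutual_indep P (fun a => Y a : T -> R).

Lemma measurable_prod_comp (f : I -> R -> R) (A : pred I) :
  (forall a, measurable_fun setT (f a)) ->
  measurable_fun setT (fun w => \prod_(a | A a) f a (Y a w)).
Proof.
move=> mf; under eq_fun do rewrite -big_filter.
apply: measurable_prod => a _.
by apply: measurableT_comp => //; exact: mf.
Qed.

Lemma ge0_integral_prod (f : I -> R -> R) :
  (forall a, measurable_fun setT (f a)) -> (forall a x, 0 <= f a x) ->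
  (forall a, P.-integrable setT (fun w => (f a (Y a w))%:E)) ->
  (\int[P]_w (\prod_a f a (Y a w))%:E
   = \prod_a \int[P]_w (f a (Y a w))%:E)%E.
Proof.
move=> mf f0 If.
(* Indicators are replaced by the [f a] one index at a time. *)
pose good (s : seq I) := forall g : I -> R -> R,
  (forall a, measurable_fun setT (g a)) -> (forall a x, 0 <= g a x) ->
  (forall a, P.-integrable setT (fun w => (g a (Y a w))%:E)) ->
  (forall a, a \notin s -> exists2 B, measurable B & g a = \1_B) ->
  (\int[P]_w (\prod_a g a (Y a w))%:E
   = \prod_a \int[P]_w (g a (Y a w))%:E)%E.
suff H s : good s.
  by apply: (H (enum I)) => // a; rewrite mem_enum.
elim: s => [|a s IH] g mg g0 Ig gB.
  (* When every factor is an indicator, the product is the indicator of an intersection and the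
     claim is the definition of [mutual_indep]. *)
  have /choice[B HB] : forall a, exists B, measurable B /\ g a = \1_B.
    by move=> a; have [//|B mB gaB] := gB a; exists B.
  have mYB b : measurable (Y b @^-1` B b).
    by rewrite -[X in measurable X]setTI; apply: measurable_funP => //; case: (HB b).
  have eB b : (\int[P]_w (g b (Y b w))%:E = P (Y b @^-1` B b))%E.
    have [mB ->] := HB b.
    rewrite -[in RHS](setIT (Y b @^-1` _)) -(integral_indic P measurableT)//.
  under [RHS]eq_bigr do rewrite eB.
  rewrite -indep; last by move=> b; case: (HB b).
  rewrite -[in RHS](setIT (bigcap _ _)) -(integral_indic P measurableT)//; last first.
    by apply: fin_bigcap_measurable => //; exact: finite_finset.
  apply: eq_integral => w _; congr (_%:E); rewrite indicE.
  case: (boolP (w \in _)).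
    rewrite inE => wB; rewrite big1// => b _; have [_ ->] := HB b.
    by rewrite indicE mem_set//; exact: wB.
  rewrite notin_setE => /existsNP[b] /not_implyP[_ wb].
  rewrite (bigD1 b)//=; have [_ ->] := HB b.
  by rewrite indicE memNset// mul0r.
(* Integrability makes the product of the other expectations finite, so [fine] loses nothing. *)
pose c := fine (\prod_(b | b != a) \int[P]_w (g b (Y b w))%:E)%E.
have cE : (c%:E = \prod_(b | b != a) \int[P]_w (g b (Y b w))%:E)%E.
  rewrite fineK// prode_fin_num// => b _; exact: integrable_fin_num.
have c0 : 0 <= c.
  apply: fine_ge0; apply: prode_ge0 => b _; apply: integral_ge0 => w _.
  by rewrite lee_fin.
transitivity (\int[P]_w (g a (Y a w) * \prod_(b | b != a) g b (Y b w))%:E)%E.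
  by apply: eq_integral => w _; rewrite (bigD1 a).
rewrite (@ge0_integral_extend_indic _ _ c)//.
- by rewrite cE [in RHS](bigD1 a)//= muleC.
- exact: measurable_prod_comp.
- by move=> w; apply: prodr_ge0.
move=> B mB.
(* With an indicator in place of [g a], the induction hypothesis applies, since [a] need no longer
   belong to the list. *)
pose g' b := if b == a then \1_B : R -> R else g b.
have mg' b : measurable_fun setT (g' b).
  by rewrite /g'; case: eqP => // _; exact: measurable_indic.
have g'0 b x : 0 <= g' b x by rewrite /g'; case: eqP.
have mYB : measurable (Y a @^-1` B).
  by rewrite -[X in measurable X]setTI; apply: measurable_funP.
have Ig' b : P.-integrable setT (fun w => (g' b (Y b w))%:E).
  by rewrite /g'; case: eqP => // ->; exact: (integrable_indic P mYB).
have /(IH _ mg' g'0 Ig') : forall b, b \notin s -> exists2 B, measurable B & g' b = \1_B.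
  move=> b bs; rewrite /g'; case: eqP => [_|/eqP ba]; first by exists B.
  by apply: gB; rewrite inE negb_or ba.
rewrite [in RHS](bigD1 a)//= {2}/g' eqxx.
under [in RHS]eq_bigr => b ba.
  rewrite /g' (negbTE ba); over.
have <- : (\int[P]_w (\1_B (Y a w))%:E = P (Y a @^-1` B))%E.
  by rewrite -[in RHS](setIT (Y a @^-1` _)) -(integral_indic P measurableT).
rewrite -cE muleC => <-.
apply: eq_integral => w _; rewrite [in RHS](bigD1 a)//= {1}/g' eqxx.
congr (_%:E); congr (_ * _); apply: eq_bigr => b ba.
by rewrite /g' (negbTE ba).
Qed.

Lemma integrable_prod (f : I -> R -> R) :
  (forall a, measurable_fun setT (f a)) ->
  (forall a, P.-integrable setT (fun w => (f a (Y a w))%:E)) ->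
  P.-integrable setT (fun w => (\prod_a f a (Y a w))%:E).
Proof.
move=> mf If; apply/integrableP; split.
  by apply/measurable_EFinP; exact: measurable_prod_comp.
under eq_integral do rewrite /= normr_prod.
rewrite (@ge0_integral_prod (fun a x => `|f a x|))//.
- rewrite ltey_eq prode_fin_num// => a _.
  by apply: integrable_fin_num => //; exact: (integrable_abse (If a)).
- by move=> a; apply: measurableT_comp.
- by move=> a; exact: (integrable_abse (If a)).
Qed.

Lemma Rintegral_prod (f : I -> R -> R) :
  (forall a, measurable_fun setT (f a)) ->
  (forall a, P.-integrable setT (fun w => (f a (Y a w))%:E)) ->
  \int[P]_w (\prod_a f a (Y a w)) = \prod_a \int[P]_w f a (Y a w).
Proof.
move=> mf If.
(* Only indices in [s] may carry functions of varying sign; such a factor is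
   split into positive and negative parts. *)
pose good (s : seq I) := forall g : I -> R -> R,
  (forall a, measurable_fun setT (g a)) ->
  (forall a, P.-integrable setT (fun w => (g a (Y a w))%:E)) ->
  (forall a x, a \notin s -> 0 <= g a x) ->
  \int[P]_w (\prod_a g a (Y a w)) = \prod_a \int[P]_w g a (Y a w).
suff H s : good s.
  by apply: (H (enum I)) => // a x; rewrite mem_enum.
elim: s => [|a s IH] g mg Ig g0.
  rewrite /Rintegral ge0_integral_prod//; last by move=> a x; exact: g0.
  apply: EFin_inj; rewrite -prodEFin fineK.
    by apply: eq_bigr => a _; rewrite fineK//; exact: integrable_fin_num.
  by rewrite prode_fin_num// => a _; exact: integrable_fin_num.
(* [gs 1] and [gs (-1)] carry the positive and the negative part of [g a] at index [a] and agree
   with [g] elsewhere. *)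
pose gs (u : R) b x := if b == a then Num.max (u * g a x) 0 else g b x.
have mgs u b : measurable_fun setT (gs u b).
  rewrite /gs; case: eqP => // _.
  by apply: measurable_maxr => //; exact: measurable_funM.
have Igs u b : P.-integrable setT (fun w => (gs u b (Y b w))%:E).
  rewrite /gs; case: eqP => // ->.
  apply: (le_integrable _ _ _ (integrableZl measurableT u (Ig a))) => //.
    apply/measurable_EFinP; apply: measurable_maxr => //.
    by apply: measurable_funM => //; apply: measurableT_comp => //; exact: mg.
  move=> w _; rewrite -EFinM /= lee_fin.
  by case: (leP (u * g a (Y a w)) 0) => // _; rewrite normr0.
have gs0 u b x : b \notin s -> 0 <= gs u b x.
  move=> bs; rewrite /gs; case: eqP => [_|/eqP ba]; first by rewrite le_max lexx orbT.
  by apply: g0; rewrite inE negb_or ba.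
have IHs u := IH (gs u) (mgs u) (Igs u) (gs0 u).
have split x : g a x = gs 1 a x - gs (-1) a x.
  rewrite /gs eqxx mul1r mulN1r.
  by case: (leP (g a x) 0); case: (leP (- g a x) 0) => ? ?; lra.
(* Used with [F] the values at a point and with [F] the expectations: only the factor at [a] depends
   on the sign. *)
have prodE u (F : (I -> R -> R) -> I -> R) :
    (forall b, b != a -> F (gs u) b = F g b) ->
    \prod_b F (gs u) b = F (gs u) a * \prod_(b | b != a) F g b.
  by move=> FE; rewrite (bigD1 a)//=; congr (_ * _); apply: eq_bigr.
transitivity (\int[P]_w (\prod_b gs 1 b (Y b w) - \prod_b gs (-1) b (Y b w))).
  apply: eq_Rintegral => w _; rewrite (bigD1 a)//= split mulrBl.
  by rewrite !(prodE _ (fun g b => g b (Y b w)))// => b ba; rewrite /gs (negbTE ba).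
rewrite RintegralB//; [|exact: integrable_prod|exact: integrable_prod].
rewrite !IHs [in RHS](bigD1 a)//=.
under [in RHS]eq_Rintegral do rewrite split.
rewrite RintegralB//; [|exact: Igs|exact: Igs].
rewrite mulrBl !(prodE _ (fun g b => \int[P]_w g b (Y b w)))// => b ba.
  by rewrite /gs (negbTE ba).
by rewrite /gs (negbTE ba).
Qed.

End product_rule.

(** * Expectation and polynomials in independent variables *)

Section real_expectation.
Set Implicit Arguments.
Unset Strict Implicit.
Context {d : measure_display} {T : measurableType d} {R : realType}.
Context (P : probability T R).

Definition intg (f : T -> R) := P.-integrable setT (fun w => (f w)%:E).
(** Real-valued, so that [ring], [lra] and [nra] apply. An infinite integral would be sent to 0,
    hence the integrability conditions carried along below. *)
Definition Ex (f : T -> R) : R := \int[P]_w f w.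

Lemma intg_cst c : intg (fun=> c).
Proof. by apply: finite_measure_integrable_cst. Qed.

Lemma intgD f g : intg f -> intg g -> intg (fun w => f w + g w).
Proof. by move=> If Ig; exact: (integrableD measurableT If Ig). Qed.

Lemma intgZ c f : intg f -> intg (fun w => c * f w).
Proof. by move=> If; exact: (integrableZl measurableT c If). Qed.

Lemma intgB f g : intg f -> intg g -> intg (fun w => f w - g w).
Proof. by move=> If Ig; exact: (integrableB measurableT If Ig). Qed.

Lemma intg_sum (J : Type) (r : seq J) (A : pred J) (f : J -> T -> R) :
  (forall j, intg (f j)) -> intg (fun w => \sum_(j <- r | A j) f j w).
Proof.
move=> If; rewrite /intg; under eq_fun do rewrite -sumEFin.
exact: (integrable_sum measurableT r (fun j _ => If j)).
Qed.

Lemma Ex_cst c : Ex (fun=> c) = c.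
Proof.
by rewrite /Ex /Rintegral integral_cst//= probability_setT mule1.
Qed.

Lemma ExD f g : intg f -> intg g -> Ex (fun w => f w + g w) = Ex f + Ex g.
Proof. by move=> If Ig; exact: RintegralD. Qed.

Lemma ExB f g : intg f -> intg g -> Ex (fun w => f w - g w) = Ex f - Ex g.
Proof. by move=> If Ig; exact: RintegralB. Qed.

Lemma ExZ c f : intg f -> Ex (fun w => c * f w) = c * Ex f.
Proof. by move=> If; exact: RintegralZl. Qed.

Lemma Ex_sum (J : Type) (r : seq J) (A : pred J) (f : J -> T -> R) :
  (forall j, intg (f j)) ->
  Ex (fun w => \sum_(j <- r | A j) f j w) = \sum_(j <- r | A j) Ex (f j).
Proof.
move=> If; elim: r => [|j r IH].
  under eq_fun do rewrite big_nil.
  by rewrite big_nil Ex_cst.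
under eq_fun do rewrite big_cons.
rewrite big_cons; case: (A j) => //.
by rewrite ExD ?IH//; exact: intg_sum.
Qed.

Lemma le_Ex f g : intg f -> intg g -> (forall w, f w <= g w) -> Ex f <= Ex g.
Proof. by move=> If Ig fg; exact: le_Rintegral. Qed.

Lemma Ex_ge0 f : (forall w, 0 <= f w) -> 0 <= Ex f.
Proof. by move=> f0; apply: Rintegral_ge0 => w _; exact: f0. Qed.

Lemma Ex_EFin f : intg f -> 'E_P[f]%E = (Ex f)%:E.
Proof. by move=> If; rewrite unlock /Ex /Rintegral fineK//; exact: integrable_fin_num. Qed.

(** Cauchy-Schwarz, from the pointwise inequality f g <= (v / 2u) f^2 + (u / 2v) g^2, which
    integrates to u v for u = x and v = y. *)
Lemma Ex_mul_le f g (x y : R) :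
  intg (fun w => f w ^+ 2) -> intg (fun w => g w ^+ 2) ->
  intg (fun w => f w * g w) -> 0 <= x -> 0 <= y ->
  Ex (fun w => f w ^+ 2) <= x ^+ 2 -> Ex (fun w => g w ^+ 2) <= y ^+ 2 ->
  Ex (fun w => f w * g w) <= x * y.
Proof.
move=> If Ig Ifg x0 y0 fx gy.
have key (u v : R) : 0 < u -> 0 < v -> x <= u -> y <= v ->
    Ex (fun w => f w * g w) <= u * v.
  move=> u0 v0 xu yv.
  have -> : u * v = v / (2 * u) * u ^+ 2 + u / (2 * v) * v ^+ 2.
    by field; rewrite !gt_eqF.
  apply: (@le_trans _ _ (Ex (fun w => v / (2 * u) * f w ^+ 2 + u / (2 * v) * g w ^+ 2))).
    apply: le_Ex => //; first by apply: intgD; exact: intgZ.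
    move=> w; rewrite -subr_ge0.
    have -> : v / (2 * u) * f w ^+ 2 + u / (2 * v) * g w ^+ 2 - f w * g w
            = (v * f w - u * g w) ^+ 2 / (2 * (u * v)).
      by field; rewrite !gt_eqF.
    by rewrite divr_ge0 ?sqr_ge0// mulr_ge0// ltW// mulr_gt0.
  rewrite ExD ?ExZ//; try exact: intgZ.
  apply: lerD; apply: ler_wpM2l; rewrite ?divr_ge0 ?mulr_ge0 ?(ltW u0) ?(ltW v0)//.
    by apply: (le_trans fx); rewrite ler_sqr ?nnegrE// ltW.
  by apply: (le_trans gy); rewrite ler_sqr ?nnegrE// ltW.
have [xy0|xy0] := boolP ((0 < x) && (0 < y)).
  by case/andP: xy0 => ? ?; exact: key.
apply/ler_addgt0Pr => eps e0.
(* The weights degenerate when [x] or [y] is 0, so both are enlarged by [del]; as [del <= 1], this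
   adds del (x + y + del) <= del (x + y + 1) <= eps. *)
pose del := Num.min 1 (eps / (x + y + 1)).
have s0 : 0 < x + y + 1 by lra.
have d0 : 0 < del by rewrite lt_min ltr01 divr_gt0.
have d1 : del <= 1 by rewrite ge_min lexx.
have d2 : del * (x + y + 1) <= eps.
  by rewrite -ler_pdivlMr// ge_min lexx orbT.
by apply: (le_trans (key (x + del) (y + del) _ _ _ _)); try lra; nra.
Qed.

Lemma Ex_norm_mul_le f g (V W : R) :
  intg (fun w => f w ^+ 2) -> intg (fun w => g w ^+ 2) ->
  intg (fun w => f w * g w) ->
  Ex (fun w => f w ^+ 2) <= V -> Ex (fun w => g w ^+ 2) <= W ->
  `|Ex (fun w => f w * g w)| <= (V + W) / 2.
Proof.
move=> If Ig Ifg fV gW.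
have I2 : intg (fun w => 2^-1 * f w ^+ 2 + 2^-1 * g w ^+ 2).
  by apply: intgD; exact: intgZ.
have E2 : Ex (fun w => 2^-1 * f w ^+ 2 + 2^-1 * g w ^+ 2) <= (V + W) / 2.
  by rewrite ExD ?ExZ//; [lra|exact: intgZ|exact: intgZ].
rewrite ler_norml; apply/andP; split; last first.
  by apply: le_trans E2; apply: le_Ex => // w; have := sqr_ge0 (f w - g w); nra.
rewrite lerNl -mulN1r -ExZ//; apply: le_trans E2.
by apply: le_Ex => //; [exact: intgZ|move=> w; have := sqr_ge0 (f w + g w); nra].
Qed.

End real_expectation.

Section polynomials.
Set Implicit Arguments.
Unset Strict Implicit.
Context {d : measure_display} {T : measurableType d} {R : realType}.
Context (P : probability T R).
Context {I : finType} (Y : I -> {RV P >-> R}).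

(* [Pol e f]: [f] is a real polynomial in the variables [Y a], of degree at most
   [e a] in [Y a]. *)
Inductive Pol (e : I -> nat) : (T -> R) -> Prop :=
| Pol_monom e' : (forall a, e' a <= e a)%N -> Pol e (fun w => \prod_a Y a w ^+ e' a)
| Pol_zero : Pol e (fun=> 0)
| Pol_lin c f g : Pol e f -> Pol e g -> Pol e (fun w => c * f w + g w).

Lemma Pol_cst e c : Pol e (fun=> c).
Proof.
have := Pol_lin c (@Pol_monom e (fun=> 0%N) (fun=> isT)) (Pol_zero e).
by congr (Pol e _); apply/funext => w; rewrite big1// mulr1 addr0.
Qed.

Lemma PolZ e c f : Pol e f -> Pol e (fun w => c * f w).
Proof.
move=> pf; have := Pol_lin c pf (Pol_zero e).
by congr (Pol e _); apply/funext => w; rewrite addr0.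
Qed.

Lemma PolD e f g : Pol e f -> Pol e g -> Pol e (fun w => f w + g w).
Proof.
move=> pf pg; have := Pol_lin 1 pf pg.
by congr (Pol e _); apply/funext => w; rewrite mul1r.
Qed.

Lemma PolB e f g : Pol e f -> Pol e g -> Pol e (fun w => f w - g w).
Proof.
move=> pf pg; have := Pol_lin (-1) pg pf.
by congr (Pol e _); apply/funext => w; rewrite mulN1r addrC.
Qed.

Lemma Pol_sum e (J : Type) (r : seq J) (A : pred J) (f : J -> T -> R) :
  (forall j, Pol e (f j)) -> Pol e (fun w => \sum_(j <- r | A j) f j w).
Proof.
move=> pf; elim: r => [|j r IH].
  by under eq_fun do rewrite big_nil; exact: Pol_zero.
under eq_fun do rewrite big_cons.
by case: (A j) => //; exact: PolD.
Qed.

Lemma Pol_le e e' f : (forall a, e a <= e' a)%N -> Pol e f -> Pol e' f.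
Proof.
move=> ee'; elim=> [e0 h| |c f0 g _ pf _ pg].
- by apply: Pol_monom => a; exact: leq_trans (h a) (ee' a).
- exact: Pol_zero.
- exact: Pol_lin.
Qed.

Lemma Pol_var e a : (0 < e a)%N -> Pol e (Y a).
Proof.
move=> ea; have := @Pol_monom e (fun b => b == a).
have -> : (fun w => \prod_b Y b w ^+ (b == a)) = (Y a : T -> R).
  apply/funext => w; rewrite (bigD1 a)//= eqxx expr1 big1 ?mulr1// => b /negbTE ->.
  by rewrite expr0.
by apply => b; case: eqP => // ->.
Qed.

Lemma PolM e e' f g : Pol e f -> Pol e' g ->
  Pol (fun a => e a + e' a)%N (fun w => f w * g w).
Proof.
move=> pf pg; elim: pf => [e1 h| |c f0 g0 _ pf _ pg0].
- elim: pg => [e2 h2| |c f0 g0 _ pf _ pg0].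
  + have := @Pol_monom (fun a => e a + e' a)%N (fun a => e1 a + e2 a)%N.
    have -> : (fun w => \prod_a Y a w ^+ (e1 a + e2 a)) =
      (fun w => \prod_a Y a w ^+ e1 a * \prod_a Y a w ^+ e2 a).
      by apply/funext => w; rewrite -big_split; apply: eq_bigr => a _; rewrite exprD.
    by apply => a; exact: leq_add.
  + by under [X in Pol _ X]eq_fun do rewrite /= mulr0; exact: Pol_zero.
  + have := Pol_lin c pf pg0.
    by congr (Pol _ _); apply/funext => w; rewrite mulrDr mulrCA.
- by under [X in Pol _ X]eq_fun do rewrite /= mul0r; exact: Pol_zero.
- have := Pol_lin c pf pg0.
  by congr (Pol _ _); apply/funext => w; rewrite mulrDl mulrA.
Qed.

Lemma PolM_le e e' e'' f g : Pol e f -> Pol e' g ->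
  (forall a, e a + e' a <= e'' a)%N -> Pol e'' (fun w => f w * g w).
Proof. by move=> pf pg h; exact: (Pol_le h (PolM pf pg)). Qed.

Lemma PolX e f n : Pol e f -> Pol (fun a => n * e a)%N (fun w => f w ^+ n).
Proof.
move=> pf; elim: n => [|n IH]; first exact: Pol_cst.
under [X in Pol _ X]eq_fun do rewrite exprS.
by apply: (PolM_le pf IH) => a; rewrite mulSn.
Qed.

Hypothesis indep : mutual_indep P (fun a => Y a : T -> R).
Hypothesis moment4 : forall a, intg P (fun w => Y a w ^+ 4).

(** Domination by 1 + y^4. *)
Lemma intg_pow a n : (n <= 4)%N -> intg P (fun w => Y a w ^+ n).
Proof.
move=> n4; apply: (le_integrable _ _ _ (intgD (intg_cst P 1) (moment4 a))) => //.
  by apply/measurable_EFinP; exact: measurable_funX.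
move=> w _ /=; rewrite lee_fin normrX [leRHS]ger0_norm; last first.
  by rewrite addr_ge0// exprn_even_ge0.
have -> : Y a w ^+ 4 = `|Y a w| ^+ 4 by rewrite -normrX ger0_norm// exprn_even_ge0.
have [x1|x1] := leP `|Y a w| 1.
  by apply: (le_trans (exprn_ile1 n _ x1)) => //; rewrite lerDl exprn_ge0.
by apply: (le_trans (ler_weXn2l (ltW x1) n4)); rewrite lerDr.
Qed.

(** The total degree may be as large as one likes: by independence a monomial is integrable as soon
    as each of its one-variable powers is. *)
Lemma Pol_intg e f : (forall a, e a <= 4)%N -> Pol e f -> intg P f.
Proof.
move=> e4; elim=> [e' h| |c f0 g _ If _ Ig].
- apply: (@integrable_prod _ _ _ P _ Y indep (fun a x => x ^+ e' a)).
    by move=> a; exact: measurable_funX.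
  by move=> a; apply: intg_pow; exact: leq_trans (h a) (e4 a).
- exact: intg_cst.
- by apply: intgD => //; exact: intgZ.
Qed.

Lemma Ex_monom e : (forall a, e a <= 4)%N ->
  Ex P (fun w => \prod_a Y a w ^+ e a) = \prod_a Ex P (fun w => Y a w ^+ e a).
Proof.
move=> e4; apply: (@Rintegral_prod _ _ _ P _ Y indep (fun a x => x ^+ e a)).
  by move=> a; exact: measurable_funX.
by move=> a; exact: intg_pow.
Qed.

(** The third condition says that [f] and [g] have no variable in common. Both sides are bilinear in
    [f] and [g], so monomials suffice, and for those [Ex_monom] factors everything. *)
Lemma Pol_indep e e' f g : (forall a, e a <= 4)%N -> (forall a, e' a <= 4)%N ->
  (forall a, (e a == 0)%N || (e' a == 0)%N) -> Pol e f -> Pol e' g ->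
  Ex P (fun w => f w * g w) = Ex P f * Ex P g.
Proof.
move=> e4 e'4 ee' pf pg.
have s4 a : (e a + e' a <= 4)%N.
  by case/orP: (ee' a) => /eqP ->; rewrite ?add0n ?addn0 ?e4 ?e'4.
have IM f0 g0 : Pol e f0 -> Pol e' g0 -> intg P (fun w => f0 w * g0 w).
  by move=> pf0 pg0; apply: (Pol_intg s4); exact: PolM.
elim: pf => [e1 h| |c f0 g0 pf0 Ef pg0 Eg].
- elim: pg => [e2 h2| |c f0 g0 pf0 Ef pg0 Eg].
  + transitivity (Ex P (fun w => \prod_a Y a w ^+ (e1 a + e2 a))).
      congr (Ex P _); apply/funext => w; rewrite -big_split.
      by apply: eq_bigr => a _; rewrite exprD.
    rewrite !Ex_monom.
    * rewrite -big_split; apply: eq_bigr => a _ /=.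
      have [a0|a0] : e1 a = 0%N \/ e2 a = 0%N.
        case/orP: (ee' a) => /eqP a0; [left|right]; apply/eqP; rewrite -leqn0.
          by rewrite -a0.
        by rewrite -a0.
      + by rewrite a0 Ex_cst mul1r.
      + by rewrite a0 Ex_cst mulr1 addn0.
    * by move=> a; exact: leq_trans (h2 a) (e'4 a).
    * by move=> a; exact: leq_trans (h a) (e4 a).
    * by move=> a; apply: leq_trans (s4 a); exact: leq_add.
  + by under eq_fun do rewrite /= mulr0; rewrite Ex_cst mulr0.
  + have pm : Pol e (fun w => \prod_a Y a w ^+ e1 a) by exact: Pol_monom.
    under eq_fun do rewrite mulrDr mulrCA.
    rewrite ExD ?ExZ ?Ef ?Eg; try by [|exact: IM|apply: intgZ; exact: IM].
    rewrite ExD ?ExZ; [ring|..]; try exact: Pol_intg e'4 _.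
    by apply: intgZ; exact: Pol_intg e'4 _.
- by under eq_fun do rewrite /= mul0r; rewrite Ex_cst mul0r.
- under eq_fun do rewrite mulrDl -mulrA.
  rewrite ExD ?ExZ ?Ef ?Eg; try by [|exact: IM|apply: intgZ; exact: IM].
  rewrite ExD ?ExZ; [ring|..]; try exact: Pol_intg e4 _.
  by apply: intgZ; exact: Pol_intg e4 _.
Qed.

End polynomials.

(** * Moments of linear and bilinear forms *)

Section moments.
Set Implicit Arguments.
Unset Strict Implicit.
Context {d : measure_display} {T : measurableType d} {R : realType}.
Context (P : probability T R).
Context {I : finType} (Y : I -> {RV P >-> R}) (gamma : R).
Hypothesis indep : mutual_indep P (fun a => Y a : T -> R).
Hypothesis intY4 : forall a, intg P (fun w => Y a w ^+ 4).
Hypothesis mean0 : forall a, Ex P (Y a) = 0.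
Hypothesis var1 : forall a, Ex P (fun w => Y a w ^+ 2) = 1.
Hypothesis moment4 : forall a, Ex P (fun w => Y a w ^+ 4) = gamma.
Hypothesis gamma0 : 0 <= gamma.

Let Pol_intg e f : (forall a, e a <= 4)%N -> Pol Y e f -> intg P f.
Proof. exact: Pol_intg. Qed.

Let Pol_indep e e' f g : (forall a, e a <= 4)%N -> (forall a, e' a <= 4)%N ->
  (forall a, (e a == 0)%N || (e' a == 0)%N) -> Pol Y e f -> Pol Y e' g ->
  Ex P (fun w => f w * g w) = Ex P f * Ex P g.
Proof. exact: Pol_indep. Qed.

Lemma Ex_powM e a n g : (n <= 4)%N -> (forall b, e b <= 4)%N -> e a = 0%N ->
  Pol Y e g -> Ex P (fun w => Y a w ^+ n * g w) = Ex P (fun w => Y a w ^+ n) * Ex P g.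
Proof.
move=> n4 e4 ea pg; apply: (@Pol_indep (fun b => n * (b == a))%N e) => //.
- by move=> b; case: eqP => _; rewrite ?muln1 ?muln0.
- by move=> b; case: (b =P a) => [->|_]; rewrite ?ea ?muln0 ?orbT.
- by apply: PolX; apply: Pol_var; rewrite eqxx.
Qed.

Lemma Ex_varM e a g : (forall b, e b <= 4)%N -> e a = 0%N ->
  Pol Y e g -> Ex P (fun w => Y a w * g w) = 0.
Proof.
move=> e4 ea pg; rewrite -[RHS](mul0r (Ex P g)) -(mean0 a).
exact: (@Ex_powM e a 1).
Qed.

(* With [S] the sum without its first term [Y a * b], independence gives
   [E (Y a * b + S)^4 = E S^4 + 6 E (b^2 S^2) + gamma E b^4], and the middle term is
   handled by the Cauchy-Schwarz inequality. *)
Lemma linear_form_moment4 (L : eqType) (J : seq L) (al : L -> I) (b : L -> T -> R)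
    (e : I -> nat) (K : R) (beta : L -> R) :
  uniq J -> injective al -> (forall a, e a <= 1)%N -> (forall s, e (al s) = 0%N) ->
  (forall s, Pol Y e (b s)) -> 0 <= K -> (forall s, 0 <= beta s) ->
  (forall s, Ex P (fun w => b s w ^+ 4) <= K * beta s ^+ 2) ->
  Ex P (fun w => (\sum_(s <- J) Y (al s) w * b s w) ^+ 4)
    <= (9 + gamma) * K * (\sum_(s <- J) beta s) ^+ 2.
Proof.
move=> uJ ial e1 eal pb K0 beta0 bK.
elim: J uJ => [_|s J IH /= /andP[sJ uJ]].
  rewrite big_nil; under eq_fun do rewrite big_nil expr0n /=.
  by rewrite Ex_cst expr0n /= mulr0.
pose S w := \sum_(s <- J) Y (al s) w * b s w.
(* A degree bound for [S] and for [b s]: at most 1 everywhere, and 0 in [Y (al s)], which is thus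
   independent of both. *)
pose eS a := (e a + (a \in map al J))%N.
have as_ : al s \notin map al J by rewrite mem_map.
have eS2 a : (eS a <= 1)%N.
  rewrite /eS; case: (boolP (a \in _)) => [/mapP[t _ ->]|_]; first by rewrite eal.
  by rewrite addn0.
have eSs : eS (al s) = 0%N by rewrite /eS eal (negbTE as_).
have e_eS a : (e a <= eS a)%N by rewrite leq_addr.
have pS : Pol Y eS S.
  (* [Pol_sum] wants a polynomial at every index, but [eS] bounds the degrees only over [J]; the
     other summands are replaced by 0. *)
  rewrite /S; under eq_fun do rewrite big_seq_cond; under eq_fun do under eq_bigl do rewrite andbT.
  have -> : (fun w => \sum_(i <- J | i \in J) Y (al i) w * b i w) =
    (fun w => \sum_(i <- J | i \in J) if i \in J then Y (al i) w * b i w else 0).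
    by apply/funext => w; apply: eq_bigr => i ->.
  apply: Pol_sum => t; case: (boolP (t \in J)) => tJ; last exact: Pol_zero.
  apply: (@PolM_le _ _ _ _ _ _ (fun a => (a == al t) : nat) e) => //.
    by apply: Pol_var; rewrite eqxx.
  move=> a; rewrite /eS addnC leq_add2l; case: eqP => // ->.
  by rewrite map_f.
have pbS : Pol Y eS (b s) by exact: Pol_le (pb s).
have e4 n (n4 : (n <= 4)%N) a : (n * eS a <= 4)%N.
  by apply: leq_trans n4; rewrite -[leqRHS]muln1 leq_mul2l eS2 orbT.
have p31 : Pol Y (fun a => 4 * eS a)%N (fun w => b s w * S w ^+ 3).
  by apply: (PolM_le pbS (PolX 3 pS)) => a; rewrite -mulSn.
have p22 : Pol Y (fun a => 4 * eS a)%N (fun w => b s w ^+ 2 * S w ^+ 2).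
  by apply: (PolM_le (PolX 2 pbS) (PolX 2 pS)) => a; rewrite -mulnDl.
have p13 : Pol Y (fun a => 4 * eS a)%N (fun w => b s w ^+ 3 * S w).
  by apply: (PolM_le (PolX 3 pbS) pS) => a; rewrite addnC -mulSn.
have p40 := PolX 4 pbS; have p04 := PolX 4 pS.
have IS n g : (n <= 4)%N -> Pol Y (fun a => 4 * eS a)%N g ->
    intg P (fun w => Y (al s) w ^+ n * g w).
  move=> n4 pg; apply: (@Pol_intg (fun a => n * (a == al s) + 4 * eS a)%N).
    by move=> a; case: eqP => [->|_]; rewrite ?eSs ?muln1 ?muln0 ?addn0// add0n; exact: e4.
  by apply: (PolM (PolX n _) pg); apply: Pol_var; rewrite eqxx.
have ES n g : (n <= 4)%N -> Pol Y (fun a => 4 * eS a)%N g ->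
    Ex P (fun w => Y (al s) w ^+ n * g w) = Ex P (fun w => Y (al s) w ^+ n) * Ex P g.
  by move=> n4 pg; apply: (Ex_powM n4 _ _ pg); [exact: e4|rewrite eSs].
(* The third moment of [Y (al s)] is unknown; its cofactor vanishes, because each term of [S]
   contains a centred variable that occurs nowhere else in the product. *)
have Ib3S : Ex P (fun w => b s w ^+ 3 * S w) = 0.
  rewrite /S; under eq_fun do rewrite mulr_sumr.
  have pt t : Pol Y (fun a => 4 * e a)%N (fun w => b s w ^+ 3 * b t w).
    by apply: (PolM_le (PolX 3 (pb s)) (pb t)) => a; rewrite addnC -mulSn.
  have ee4 a : (4 * e a <= 4)%N by rewrite -[leqRHS]muln1 leq_mul2l e1.
  have eq t : (fun w => b s w ^+ 3 * (Y (al t) w * b t w)) =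
      (fun w => Y (al t) w * (b s w ^+ 3 * b t w)).
    by apply/funext => w; rewrite mulrCA.
  rewrite Ex_sum ?big1// => [t _|t]; rewrite eq.
    by apply: Ex_varM (pt t) => //; rewrite eal.
  apply: (@Pol_intg (fun a => 1 * (a == al t) + 4 * e a)%N).
    by move=> a; case: (a =P al t) => [->|_]; rewrite ?eal ?muln0 ?add0n ?ee4.
  by apply: PolM (pt t); apply: Pol_var; rewrite eqxx.
have -> : Ex P (fun w => (\sum_(s <- s :: J) Y (al s) w * b s w) ^+ 4) =
   Ex P (fun w => S w ^+ 4) + 6 * Ex P (fun w => b s w ^+ 2 * S w ^+ 2)
   + gamma * Ex P (fun w => b s w ^+ 4).
  have -> : (fun w => (\sum_(s <- s :: J) Y (al s) w * b s w) ^+ 4) =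
     (fun w => S w ^+ 4 + 4 * (Y (al s) w ^+ 1 * (b s w * S w ^+ 3))
       + 6 * (Y (al s) w ^+ 2 * (b s w ^+ 2 * S w ^+ 2))
       + 4 * (Y (al s) w ^+ 3 * (b s w ^+ 3 * S w)) + Y (al s) w ^+ 4 * b s w ^+ 4).
    by apply/funext => w; rewrite big_cons -/(S w); ring.
  have I04 : intg P (fun w => S w ^+ 4) by apply: Pol_intg p04; exact: e4.
  rewrite !ExD ?ExZ; try by do ![exact: I04|exact: IS|apply: intgD|apply: intgZ].
  rewrite !ES// Ib3S var1 moment4.
  have -> : Ex P (fun w => Y (al s) w ^+ 1) = 0 by exact: mean0.
  by ring.
rewrite big_cons.
set B := \sum_(s <- J) beta s.
have B0 : 0 <= B by exact: sumr_ge0.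
have {}IH : Ex P (fun w => S w ^+ 4) <= (9 + gamma) * K * B ^+ 2 by exact: IH.
have CS : Ex P (fun w => b s w ^+ 2 * S w ^+ 2) <=
    (Num.sqrt K * beta s) * (Num.sqrt ((9 + gamma) * K) * B).
  have s2 (f : T -> R) : (fun w => (f w ^+ 2) ^+ 2) = (fun w => f w ^+ 4).
    by apply/funext => w; rewrite -exprM.
  apply: Ex_mul_le; rewrite ?s2 ?exprMn ?sqr_sqrtr ?mulr_ge0 ?sqrtr_ge0 ?addr_ge0//.
  - by apply: Pol_intg p40; exact: e4.
  - by apply: Pol_intg p04; exact: e4.
  - by apply: Pol_intg p22; exact: e4.
(* The origin of 9 + gamma: Cauchy-Schwarz gives the middle term 6 K sqrt(9 + gamma) beta B, which
   must fit into the cross term 2 (9 + gamma) K beta B of the square. This asks for 3 <= sqrt(9 +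
   gamma). *)
have sq : 3 * (Num.sqrt K * Num.sqrt ((9 + gamma) * K)) <= (9 + gamma) * K.
  rewrite sqrtrM ?addr_ge0//.
  have -> : 3 * (Num.sqrt K * (Num.sqrt (9 + gamma) * Num.sqrt K)) =
     3 * Num.sqrt (9 + gamma) * Num.sqrt K ^+ 2 by ring.
  rewrite sqr_sqrtr// ler_wpM2r//.
  have h9 : 0 <= 9 + gamma by rewrite addr_ge0.
  rewrite -{2}(sqr_sqrtr h9) expr2 ler_wpM2r ?sqrtr_ge0//.
  have -> : 3 = Num.sqrt (3 ^+ 2) :> R by rewrite sqrtr_sqr ger0_norm.
  rewrite ler_sqrt ?addr_ge0//; have -> : (3 : R) ^+ 2 = 9 by ring.
  by rewrite lerDl.
have := bK s; have := beta0 s; move: CS sq IH.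
set q := Num.sqrt K; set q' := Num.sqrt _; set E4 := Ex P (fun w => S w ^+ 4).
set Eb := Ex P (fun w => b s w ^+ 4); set Ebs := Ex P _.
move=> CS sq IH bs0 Ebb.
have h1 : gamma * Eb <= gamma * (K * beta s ^+ 2) by exact: ler_wpM2l.
have h2 : 3 * (q * q') * (beta s * B) <= (9 + gamma) * K * (beta s * B).
  by apply: ler_wpM2r; rewrite ?mulr_ge0.
have h3 : 0 <= 9 * K * beta s ^+ 2 by rewrite !mulr_ge0// sqr_ge0.
nra.
Qed.

Lemma bilinear_form_moment4 (S U : finType) (al : S -> I) (be : U -> I) (A : S -> U -> R) :
  injective al -> injective be -> (forall s t, al s != be t) ->
  Ex P (fun w => (\sum_s \sum_t A s t * (Y (al s) w * Y (be t) w)) ^+ 4)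
    <= (9 + gamma) ^+ 2 * (\sum_s \sum_t A s t ^+ 2) ^+ 2.
Proof.
move=> ial ibe alb.
pose b s w := \sum_t Y (be t) w * A s t.
pose e a := (a \in codom be) : nat.
have -> : (fun w => (\sum_s \sum_t A s t * (Y (al s) w * Y (be t) w)) ^+ 4) =
    (fun w => (\sum_s Y (al s) w * b s w) ^+ 4).
  apply/funext => w; congr (_ ^+ 4); apply: eq_bigr => s _.
  by rewrite mulr_sumr; apply: eq_bigr => t _; ring.
(* The constant is brought to the form [(9 + gamma) * K] with [K = (9 + gamma) * 1], the bound that
   the application with constant coefficients provides for the coefficients of the outer form. *)
rewrite expr2 -[9 + gamma in leRHS]mulr1 -mulrA mulr1 mulrA.
have -> : (9 + gamma) * (9 + gamma) = (9 + gamma) * ((9 + gamma) * 1) by ring.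
apply: (@linear_form_moment4 _ _ _ _ e) => //.
- exact: index_enum_uniq.
- by move=> a; rewrite /e; case: (_ \in _).
- by move=> s; rewrite /e; case: codomP => // -[t /eqP]; rewrite (negbTE (alb s t)).
- move=> s; apply: Pol_sum => t; rewrite /b.
  under eq_fun do rewrite mulrC.
  by apply: PolZ; apply: Pol_var; rewrite /e codom_f.
- by rewrite mulr1 addr_ge0.
- by move=> s; apply: sumr_ge0 => t _; exact: sqr_ge0.
- move=> s; apply: (@linear_form_moment4 _ _ _ (fun t _ => A s t) (fun=> 0%N) 1) => //.
  + exact: index_enum_uniq.
  + by move=> t; exact: Pol_cst.
  + by move=> t; exact: sqr_ge0.
  + by move=> t; rewrite Ex_cst mul1r -exprM.
Qed.

(** The products u_s v_t are orthogonal, each with second moment ku kv. Stated for general families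
    because it serves both for the coordinates of y_ik (constants 1) and for those of y_ik - y_ir
    (constants 2). *)
Lemma bilinear_form_moment2 (S U : finType) (u : S -> T -> R) (v : U -> T -> R)
    (eu ev : I -> nat) (A : S -> U -> R) (ku kv : R) :
  (forall a, eu a <= 2)%N -> (forall a, ev a <= 2)%N ->
  (forall a, (eu a == 0)%N || (ev a == 0)%N) ->
  (forall s, Pol Y eu (u s)) -> (forall t, Pol Y ev (v t)) ->
  (forall s s', Ex P (fun w => u s w * u s' w) = ku * (s == s')%:R) ->
  (forall t t', Ex P (fun w => v t w * v t' w) = kv * (t == t')%:R) ->
  Ex P (fun w => (\sum_s \sum_t A s t * (u s w * v t w)) ^+ 2)
  = ku * kv * \sum_s \sum_t A s t ^+ 2.
Proof.
move=> eu2 ev2 euv pu pv cu cv.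
have pt s t : Pol Y (fun a => eu a + ev a)%N (fun w => u s w * v t w) by exact: PolM.
have euv2 a : (eu a + ev a <= 2)%N.
  by case/orP: (euv a) => /eqP ->; rewrite ?addn0 ?add0n ?eu2 ?ev2.
have pc s t s' t' : intg P (fun w => (u s w * v t w) * (u s' w * v t' w)).
  apply: (@Pol_intg (fun a => (eu a + ev a) + (eu a + ev a))%N).
    by move=> a; apply: (@leq_add _ _ 2 2).
  exact: PolM.
have Ec s t s' t' : Ex P (fun w => (u s w * v t w) * (u s' w * v t' w)) =
    ku * (s == s')%:R * (kv * (t == t')%:R).
  rewrite -cu -cv; under eq_fun do rewrite mulrACA.
  apply: (@Pol_indep (fun a => eu a + eu a)%N (fun a => ev a + ev a)%N).
  - by move=> a; apply: (@leq_add _ _ 2 2).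
  - by move=> a; apply: (@leq_add _ _ 2 2).
  - by move=> a; rewrite !addn_eq0 !andbb.
  - exact: PolM.
  - exact: PolM.
have -> : (fun w => (\sum_s \sum_t A s t * (u s w * v t w)) ^+ 2) =
  (fun w => \sum_s \sum_t \sum_s' \sum_t'
     A s t * A s' t' * ((u s w * v t w) * (u s' w * v t' w))).
  apply/funext => w; rewrite expr2 mulr_suml; apply: eq_bigr => s _.
  rewrite mulr_suml; apply: eq_bigr => t _.
  rewrite mulr_sumr; apply: eq_bigr => s' _.
  rewrite mulr_sumr; apply: eq_bigr => t' _; ring.
rewrite mulr_sumr Ex_sum => [|s]; last by do ![apply: intg_sum => ?|exact: intgZ].
apply: eq_bigr => s _.
rewrite mulr_sumr Ex_sum => [|t]; last by do ![apply: intg_sum => ?|exact: intgZ].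
apply: eq_bigr => t _.
rewrite Ex_sum => [|s']; last by do ![apply: intg_sum => ?|exact: intgZ].
(* By orthogonality only the term with [s' = s] and [t' = t] survives. *)
rewrite (bigD1 s)//= Ex_sum => [|t']; last exact: intgZ.
rewrite (bigD1 t)//= ExZ// Ec !eqxx big1 => [|t' tt']; last first.
  by rewrite ExZ// Ec eq_sym (negbTE tt') !mulr0.
rewrite big1 => [|s' ss']; first by rewrite (_ : true%:R = 1 :> R)//; ring.
rewrite Ex_sum => [|t']; last exact: intgZ.
rewrite big1// => t' _.
by rewrite ExZ// Ec eq_sym (negbTE ss') mulr0 mul0r mulr0.
Qed.

(** The bilinear case with the second family reduced to the single constant 1. *)
Lemma linear_form_moment2 (S : finType) (u : S -> T -> R) (eu : I -> nat)
    (c : S -> R) (ku : R) :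
  (forall a, eu a <= 2)%N -> (forall s, Pol Y eu (u s)) ->
  (forall s s', Ex P (fun w => u s w * u s' w) = ku * (s == s')%:R) ->
  Ex P (fun w => (\sum_s c s * u s w) ^+ 2) = ku * \sum_s c s ^+ 2.
Proof.
move=> eu2 pu cu.
transitivity (Ex P (fun w => (\sum_s \sum_(t : unit) c s * (u s w * 1)) ^+ 2)).
  congr (Ex P _); apply/funext => w; congr (_ ^+ 2); apply: eq_bigr => s _.
  by rewrite (big_pred1 tt) ?mulr1// => -[].
rewrite (@bilinear_form_moment2 S unit u (fun _ _ => 1) eu (fun=> 0%N) (fun s _ => c s) ku 1)//.
- by rewrite mulr1; congr (_ * _); apply: eq_bigr => s _; rewrite (big_pred1 tt)// => -[].
- by move=> a; rewrite orbT.
- by move=> _; exact: Pol_cst.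
- by move=> [] []; rewrite Ex_cst eqxx !mulr1.
Qed.

Lemma Ex_var_var a b : Ex P (fun w => Y a w * Y b w) = (a == b)%:R.
Proof.
case: eqP => [<-|/eqP ab]; first by under eq_fun do rewrite -expr2.
apply: (@Ex_varM (fun c => (c == b) : nat)) => //.
- by move=> c; case: eqP.
- by rewrite (negbTE ab).
- by apply: Pol_var; rewrite eqxx.
Qed.

End moments.

(** * Covariance of U-statistics *)

Section ustatistics.
Set Implicit Arguments.
Unset Strict Implicit.
Context {d : measure_display} {T : measurableType d} {R : realType}.
Context (P : probability T R).

Lemma covariance_Ex (f g : T -> R) : intg P f -> intg P g ->
  intg P (fun w => (f w - Ex P f) * (g w - Ex P g)) ->
  covariance P f g = (Ex P (fun w => (f w - Ex P f) * (g w - Ex P g)))%:E.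
Proof.
move=> If Ig Ifg; rewrite unlock -Ex_EFin// !Ex_EFin//=.
Qed.

Lemma chebyshev_Ex (f : T -> R) (c eps : R) : 0 < eps -> intg P f ->
  intg P (fun w => (f w - c) * (f w - c)) ->
  (P [set w | (eps < `|f w - c|)%R]
     <= (Ex P (fun w => (f w - c) * (f w - c)) / eps ^+ 2)%:E)%E.
Proof.
move=> e0 If Iff; set A := [set w | _].
have mA : measurable A.
  have mf : measurable_fun setT f by apply/measurable_EFinP; exact: (measurable_int _ If).
  have mA' : measurable_fun setT (fun w => `|f w - c|).
    by apply: measurableT_comp => //; exact: measurable_funB.
  rewrite -[A]setTI (_ : A = (fun w => `|f w - c|) @^-1` `]eps, +oo[%classic).
    by apply: mA' => //; exact: measurable_itv.
  by rewrite set_itvoy.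
have IA : intg P (\1_A : T -> R) by exact: integrable_indic.
have EA : (P A = (Ex P (\1_A : T -> R))%:E)%E.
  rewrite /Ex /Rintegral fineK; last exact: integrable_fin_num.
  by rewrite integral_indic// setIT.
rewrite EA lee_fin ler_pdivlMr ?exprn_gt0// mulrC -ExZ//.
apply: le_Ex => //; first exact: intgZ.
move=> w; rewrite indicE; case: (boolP (w \in A)) => [|_]; last first.
  by rewrite mulr0 -expr2 sqr_ge0.
rewrite inE /A /= => ew; rewrite mulr1 -expr2 -[leRHS]real_normK ?num_real//.
by rewrite ler_sqr ?nnegrE// ltW.
Qed.

(** As the mean is 1, the last clause bounds the variance; the same data yield both the variance
    bounds and, through Chebyshev, the consistency. *)
Definition near1 (f : T -> R) (B : R) := [/\ intg P f, Ex P f = 1,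
  intg P (fun w => (f w - 1) * (f w - 1)) & Ex P (fun w => (f w - 1) * (f w - 1)) <= B].

Lemma near1_var f B : near1 f B -> ('V_P[f] <= B%:E)%E.
Proof.
by move=> [If f1 If2 fB]; rewrite /variance covariance_Ex// ?f1// lee_fin.
Qed.

Lemma near1_cvg f B eps : 0 < eps -> near1 f B ->
  (P [set w | (eps < `|f w - 1|)%R] <= (B / eps ^+ 2)%:E)%E.
Proof.
move=> e0 [If f1 If2 fB]; apply: (le_trans (chebyshev_Ex e0 If If2)).
by rewrite lee_fin ler_wpM2r// invr_ge0 sqr_ge0.
Qed.

Context {Q Q' : finType} {B : eqType} {m m' : nat}.
Context (c : 'I_m -> Q -> B) (c' : 'I_m' -> Q' -> B) (rho : R).
Hypothesis balanced : forall a x, #|[pred q | c a q == x]|%:R <= rho * #|Q|%:R.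

(** A union bound over the m m' pairs of positions: for fixed [q'], [a] and [b], at most rho |Q|
    indices [q] have the block [c' b q'] at position [a]. Only [c] has to be balanced, so [rho]
    depends on the first statistic alone. *)
Lemma card_touching :
  \sum_q \sum_q' [exists a, exists b, c a q == c' b q']%:R
  <= m%:R * m'%:R * rho * #|Q|%:R * #|Q'|%:R :> R.
Proof.
rewrite exchange_big /=.
have -> : m%:R * m'%:R * rho * #|Q|%:R * #|Q'|%:R =
   \sum_(q' : Q') \sum_(a < m) \sum_(b < m') rho * #|Q|%:R :> R.
  by rewrite !sumr_const !card_ord; ring.
apply: ler_sum => q' _.
apply: (@le_trans _ _ (\sum_a \sum_b \sum_q (c a q == c' b q')%:R)).
  under [leRHS]eq_bigr do rewrite exchange_big /=.
  rewrite [leRHS]exchange_big /=; apply: ler_sum => q _.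
  have pos a : 0 <= \sum_b (c a q == c' b q')%:R :> R by apply: sumr_ge0.
  case: existsP => [[a /existsP[b cab]]|_]; last exact: sumr_ge0.
  rewrite (bigD1 a)//= (bigD1 b)//= cab -addrA lerDl addr_ge0//; exact: sumr_ge0.
apply: ler_sum => a _; apply: ler_sum => b _.
apply: le_trans (balanced a (c' b q')).
rewrite -natr_sum ler_nat -sum1_card [leqRHS]big_mkcond /=; apply: leq_sum => q _.
by rewrite inE; case: (c a q == _).
Qed.

(* Pairs of kernels that share no block are uncorrelated, so only touching pairs
   of indices contribute. *)
Lemma ustat_cov_bound (v : pred Q) (v' : pred Q') (h : Q -> T -> R) (h' : Q' -> T -> R)
    (V : R) :
  (forall q, v q -> intg P (fun w => h q w ^+ 2)) ->
  (forall q, v' q -> intg P (fun w => h' q w ^+ 2)) ->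
  (forall q q', v q -> v' q' -> intg P (fun w => h q w * h' q' w)) ->
  (forall q, v q -> Ex P (fun w => h q w ^+ 2) <= V) ->
  (forall q, v' q -> Ex P (fun w => h' q w ^+ 2) <= V) ->
  (forall q q', v q -> v' q' -> (forall a b, c a q != c' b q') ->
     Ex P (fun w => h q w * h' q' w) = 0) ->
  0 <= V ->
  `|Ex P (fun w => (\sum_(q | v q) h q w) * (\sum_(q | v' q) h' q w))|
  <= m%:R * m'%:R * rho * #|Q|%:R * #|Q'|%:R * V.
Proof.
move=> Ih Ih' Ihh hV h'V h0 V0.
(* Extension by 0 lets the double sum run over all pairs of tuples, where [card_touching] counts. *)
pose g q w := if v q then h q w else 0.
pose g' q w := if v' q then h' q w else 0.
have Ig q q' : intg P (fun w => g q w * g' q' w).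
  rewrite /g /g'; case: (boolP (v q)) => vq; last first.
    by under eq_fun do rewrite mul0r; exact: intg_cst.
  case: (boolP (v' q')) => vq'; first exact: Ihh.
  by under eq_fun do rewrite mulr0; exact: intg_cst.
have -> : (fun w => (\sum_(q | v q) h q w) * (\sum_(q | v' q) h' q w)) =
    (fun w => \sum_q \sum_q' g q w * g' q' w).
  apply/funext => w; rewrite [X in X * _]big_mkcond [X in _ * X]big_mkcond /= mulr_suml.
  by apply: eq_bigr => q _; rewrite mulr_sumr.
rewrite Ex_sum; last by move=> q; apply: intg_sum.
apply: (le_trans (ler_norm_sum _ _ _)).
apply: (@le_trans _ _ (\sum_q \sum_q' [exists a, exists b, c a q == c' b q']%:R * V)); last first.
  under eq_bigr do rewrite -mulr_suml.
  by rewrite -mulr_suml ler_wpM2r// card_touching.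
apply: ler_sum => q _; rewrite Ex_sum//.
apply: (le_trans (ler_norm_sum _ _ _)); apply: ler_sum => q' _.
rewrite /g /g'; case: (boolP (v q)) => vq; last first.
  by under eq_fun do rewrite mul0r; rewrite Ex_cst normr0 mulr_ge0.
case: (boolP (v' q')) => vq'; last first.
  by under eq_fun do rewrite mulr0; rewrite Ex_cst normr0 mulr_ge0.
case: (boolP [exists a, exists b, c a q == c' b q']) => [_|/existsPn nt].
  rewrite mul1r (_ : V = (V + V) / 2); last by lra.
  by apply: Ex_norm_mul_le; [exact: Ih|exact: Ih'|exact: Ihh|exact: hV|exact: h'V].
rewrite h0// ?normr0 ?mul0r// => a b; have /existsPn := nt a; exact.
Qed.

End ustatistics.

(** * Traces and numbers of distinct indices *)

Section matrix_identities.
Set Implicit Arguments.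
Unset Strict Implicit.
Context {R : realFieldType} {p : nat}.
Implicit Types (M N : 'M[R]_p) (u v : 'cV[R]_p).

Lemma dotvE u v : dotv u v = (u^T *m v) 0 0.
Proof. by rewrite mxE; apply: eq_bigr => s _; rewrite mxE. Qed.

Lemma dotvDl u u' v : dotv (u + u') v = dotv u v + dotv u' v.
Proof. by rewrite !dotvE linearD mulmxDl mxE. Qed.

Lemma dotvDr u v v' : dotv u (v + v') = dotv u v + dotv u v'.
Proof. by rewrite !dotvE mulmxDr mxE. Qed.

Lemma dotv_sub u v :
  dotv (u - v) (u - v) = dotv u u + dotv v v - 2 * dotv u v.
Proof.
rewrite /dotv mulr_sumr -!big_split -sumrB /=.
by apply: eq_bigr => s _; rewrite !mxE; ring.
Qed.

Lemma dotv_mul_l M u v : dotv v (M *m u) = \sum_t (M^T *m v) t 0 * u t 0.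
Proof.
rewrite dotvE mulmxA mxE; apply: eq_bigr => t _; congr (_ * _).
by rewrite -[in RHS](trmxK v) -trmx_mul [in RHS]mxE.
Qed.

Lemma dotv_mul2 M N u v :
  dotv (M *m u) (N *m v) = \sum_a \sum_b (M^T *m N) a b * (u a 0 * v b 0).
Proof.
rewrite dotvE trmx_mul -mulmxA (mulmxA M^T) mulmxA mxE exchange_big /=.
apply: eq_bigr => b _; rewrite mxE mulr_suml; apply: eq_bigr => a _.
by rewrite [in LHS]mxE; ring.
Qed.

Lemma dotvC u v : dotv u v = dotv v u.
Proof. by apply: eq_bigr => s _; rewrite mulrC. Qed.

Lemma bform_gram M u :
  bform u (M *m M^T) u = \sum_t ((M^T *m u) t 0) ^+ 2.
Proof.
rewrite /bform !mulmxA -[u^T *m M]trmxK trmx_mul trmxK -mulmxA mxE.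
by apply: eq_bigr => t _; rewrite mxE expr2.
Qed.

Lemma mxtrace_gram2 M N :
  \tr ((M *m M^T) *m (N *m N^T)) = \sum_a \sum_b ((M^T *m N) a b) ^+ 2.
Proof.
rewrite -!mulmxA mxtrace_mulC.
have -> : M^T *m (N *m N^T) *m M = (M^T *m N) *m (M^T *m N)^T.
  by rewrite trmx_mul trmxK !mulmxA.
apply: eq_bigr => a _; rewrite mxE; apply: eq_bigr => b _.
by rewrite [_^T _ _]mxE expr2.
Qed.

Lemma mxtrace_gram M : \tr (M *m M^T) = \sum_a \sum_s (M s a) ^+ 2.
Proof.
rewrite exchange_big; apply: eq_bigr => s _; rewrite mxE.
by apply: eq_bigr => a _; rewrite mxE expr2.
Qed.

(** Lagrange's identity: twice the difference of the two sides is a sum of squares. *)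
Lemma sum_CauchySchwarz (S : finType) (x z : S -> R) :
  (\sum_s x s * z s) ^+ 2 <= (\sum_s x s ^+ 2) * (\sum_s z s ^+ 2).
Proof.
have : 0 <= \sum_s \sum_t (x s * z t - x t * z s) ^+ 2.
  by apply: sumr_ge0 => s _; apply: sumr_ge0 => t _; exact: sqr_ge0.
have -> : \sum_s \sum_t (x s * z t - x t * z s) ^+ 2 =
   2 * ((\sum_s x s ^+ 2) * (\sum_s z s ^+ 2) - (\sum_s x s * z s) ^+ 2).
  have e1 : (\sum_s x s ^+ 2) * (\sum_s z s ^+ 2) = \sum_s \sum_t x s ^+ 2 * z t ^+ 2.
    by rewrite mulr_suml; apply: eq_bigr => s _; rewrite mulr_sumr.
  have e2 : (\sum_s x s ^+ 2) * (\sum_s z s ^+ 2) = \sum_s \sum_t x t ^+ 2 * z s ^+ 2.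
    by rewrite e1 exchange_big.
  have e3 : (\sum_s x s * z s) ^+ 2 = \sum_s \sum_t (x s * z s) * (x t * z t).
    by rewrite expr2 mulr_suml; apply: eq_bigr => s _; rewrite mulr_sumr.
  rewrite mulrBr {1}mulr_natl mulr2n {1}e1 e2 e3 -big_split mulr_sumr -sumrB /=.
  apply: eq_bigr => s _; rewrite -big_split mulr_sumr -sumrB /=.
  by apply: eq_bigr => t _; ring.
lra.
Qed.

(** Submultiplicativity of the Frobenius norm, applied to M'N. It turns the bound O(p) on the traces
    into O(p^2) for tr(Sigma_i Sigma_j). *)
Lemma mxtrace_gram2_le M N :
  \tr ((M *m M^T) *m (N *m N^T)) <= \tr (M *m M^T) * \tr (N *m N^T).
Proof.
rewrite mxtrace_gram2 !mxtrace_gram mulr_suml; apply: ler_sum => a _.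
rewrite mulr_sumr; apply: ler_sum => b _; rewrite mxE.
under eq_bigr do rewrite mxE.
exact: sum_CauchySchwarz.
Qed.

(** Makes the denominators of the ratios positive. The trace is a sum of squares and vanishes only
    if M'N = 0; but then, for e != 0, the vector u = N N'e is nonzero and u' M M' u = 0, against
    positive definiteness. *)
Lemma posdef_gram2_gt0 M N : (0 < p)%N ->
  posdef (M *m M^T) -> posdef (N *m N^T) -> 0 < \tr ((M *m M^T) *m (N *m N^T)).
Proof.
move=> p0 [_ HM] [_ HN].
have mul_col a : col a (M^T *m N) = M^T *m col a N.
  by apply/matrixP => s t; rewrite !mxE; apply: eq_bigr => r _; rewrite !mxE.
have M0 : exists a, M^T *m (col a N) != 0.
  apply/existsP; apply: contraT => /existsPn M0.
  pose e : 'cV[R]_p := delta_mx (Ordinal p0) 0.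
  have e0 : e != 0.
    apply/eqP => /matrixP/(_ (Ordinal p0) 0); rewrite !mxE !eqxx /=.
    by move/eqP; rewrite oner_eq0.
  have MN0 : M^T *m N = 0.
    apply/matrixP => a b; have /negPn/eqP := M0 b.
    by rewrite -mul_col => /matrixP/(_ a 0); rewrite !mxE.
  have NM0 : N^T *m M = 0 by rewrite -(trmxK M) -trmx_mul MN0 trmx0.
  have [Ne|Ne] := eqVneq (N^T *m e) 0.
    by have := HN e e0; rewrite /bform -!mulmxA Ne !mulmx0 mxE ltxx.
  have /HM : N *m (N^T *m e) != 0.
    apply/eqP => NN; have := HN e e0.
    by rewrite /bform -!mulmxA NN mulmx0 mxE ltxx.
  by rewrite /bform -!mulmxA (mulmxA M^T N) MN0 mul0mx !mulmx0 mxE ltxx.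
have [a Ma] := M0.
rewrite mxtrace_gram2 lt_neqAle; apply/andP; split; last first.
  by apply: sumr_ge0 => ? _; apply: sumr_ge0 => ? _; exact: sqr_ge0.
apply: contra Ma => /eqP/esym/eqP; rewrite psumr_eq0; last first.
  by move=> ? _; apply: sumr_ge0 => ? _; exact: sqr_ge0.
move=> /allP H; apply/eqP; rewrite -mul_col; apply/matrixP => s t; rewrite [RHS]mxE.
have /H /= : s \in index_enum 'I_p by rewrite mem_index_enum.
rewrite psumr_eq0 => [/allP/(_ a)|? _]; last exact: sqr_ge0.
rewrite mem_index_enum sqrf_eq0 => /(_ isT)/eqP <-.
by rewrite mxE.
Qed.

End matrix_identities.

Section counting.
Set Implicit Arguments.
Unset Strict Implicit.

(** Gives [Ei] and [Eij] one index type, pairs of pairs, so that they differ only in the predicate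
    that selects the tuples. *)
Lemma sum4E (V : nmodType) (m n : nat) (F : ('I_m * 'I_m) * ('I_n * 'I_n) -> V) :
  \sum_(k < m) \sum_(r < m) \sum_(l < n) \sum_(s < n) F ((k, r), (l, s)) = \sum_q F q.
Proof.
under eq_bigr do under eq_bigr do rewrite pair_bigA /=.
rewrite pair_bigA /= pair_bigA /=.
by apply: eq_bigr => -[[k r] [l s]] _.
Qed.

(** Counts the choices of one more index; each use yields one factor of a falling factorial. *)
Lemma count_uniq_rcons n (s : seq 'I_n) :
  (\sum_(x < n | uniq (rcons s x)) 1 = uniq s * (n - size s))%N.
Proof.
under eq_bigl do rewrite rcons_uniq.
have [us|us] := boolP (uniq s); last by rewrite big_pred0// => x; rewrite andbF.
under eq_bigl do rewrite andbT.
rewrite mul1n sum1_card.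
have := cardC (mem s); rewrite (card_uniqP us) => ns.
transitivity (size s + #|[predC mem s]| - size s)%N; first by rewrite addKn; apply: eq_card.
by rewrite ns card_ord.
Qed.

Definition distinct4 n : pred (('I_n * 'I_n) * ('I_n * 'I_n)) :=
  fun q => uniq [:: q.1.1; q.1.2; q.2.1; q.2.2].

Definition distinct22 m n : pred (('I_m * 'I_m) * ('I_n * 'I_n)) :=
  fun q => (q.1.1 != q.1.2) && (q.2.1 != q.2.2).

Definition distinct2 n : pred ('I_n * 'I_n) := fun q => q.1 != q.2.

Lemma card_distinct2 n : #|@distinct2 n| = (n * (n - 1))%N.
Proof.
rewrite -sum1_card big_mkcond /= (eq_bigr (fun q => if uniq [:: q.1; q.2] then 1 else 0))%N;
  last by move=> q _; rewrite /= inE andbT.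
rewrite -(pair_bigA _ (fun k r => if uniq [:: k; r] then 1 else 0)%N) /=.
under eq_bigr => k _.
  rewrite -big_mkcond; rewrite (count_uniq_rcons [:: k]) /= mul1n; over.
by rewrite sum_nat_const card_ord.
Qed.

Lemma card_distinct22 m n : #|@distinct22 m n| = (m * (m - 1) * (n * (n - 1)))%N.
Proof. by rewrite (@eq_card _ _ [predX @distinct2 m & @distinct2 n])// cardX !card_distinct2. Qed.

Lemma card_distinct4 n : #|@distinct4 n| = (n * (n - 1) * (n - 2) * (n - 3))%N.
Proof.
rewrite -sum1_card big_mkcond /= -sum4E.
have c3 k r l : (\sum_(s < n) (if @distinct4 n ((k, r), (l, s)) then 1 else 0) =
    uniq [:: k; r; l] * (n - 3))%N.
  by rewrite -big_mkcond; exact: (count_uniq_rcons [:: k; r; l]).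
have c2 k r : (\sum_(l < n) uniq [:: k; r; l] * (n - 3) = uniq [:: k; r] * (n - 2) * (n - 3))%N.
  rewrite -big_distrl /=; congr (_ * _)%N.
  rewrite -(count_uniq_rcons [:: k; r]) [RHS]big_mkcond /=; apply: eq_bigr => l _.
  by case: ifP.
have c1 k : (\sum_(r < n) uniq [:: k; r] * (n - 2) * (n - 3) = (n - 1) * (n - 2) * (n - 3))%N.
  rewrite -!big_distrl /=; congr (_ * _ * _)%N.
  rewrite -[RHS]mul1n -[RHS](count_uniq_rcons [:: k]) [RHS]big_mkcond /=; apply: eq_bigr => r _.
  by case: ifP.
under eq_bigr do under eq_bigr do under eq_bigr do rewrite c3.
under eq_bigr do under eq_bigr do rewrite c2.
under eq_bigr do rewrite c1.
by rewrite sum_nat_const card_ord !mulnA.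
Qed.

(** The ratio n^3 / ((n - 1)(n - 2)(n - 3)) decreases in n and equals 64/6 < 11 at n = 4. *)
Lemma card_distinct4_ge n : (4 <= n)%N ->
  (#|{: ('I_n * 'I_n) * ('I_n * 'I_n)}| <= 11 * #|@distinct4 n|)%N.
Proof.
rewrite card_distinct4 !card_prod card_ord => n4.
have -> : n = (n - 4 + 4)%N by rewrite subnK.
move: (n - 4)%N => m.
have -> : (m + 4 - 1 = m + 3)%N by lia.
have -> : (m + 4 - 2 = m + 2)%N by lia.
have -> : (m + 4 - 3 = m + 1)%N by lia.
nia.
Qed.

(** Each sample costs a factor 2, so 4 would do; 11 is kept to have one constant for both kinds of
    tuples. *)
Lemma card_distinct22_ge m n : (4 <= m)%N -> (4 <= n)%N ->
  (#|{: ('I_m * 'I_m) * ('I_n * 'I_n)}| <= 11 * #|@distinct22 m n|)%N.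
Proof.
rewrite card_distinct22 !card_prod !card_ord => m4 n4.
have h k : (4 <= k -> k * k <= 2 * (k * (k - 1)))%N.
  by move=> k4; rewrite mulnCA leq_mul2l; apply/orP; right; lia.
apply: leq_trans (leq_mul (h m m4) (h n n4)) _.
by rewrite mulnACA leq_mul2r orbT.
Qed.

Lemma card_distinct2_ge n : (4 <= n)%N -> (#|{: 'I_n * 'I_n}| <= 2 * #|@distinct2 n|)%N.
Proof.
rewrite card_distinct2 card_prod card_ord => n4.
by rewrite mulnCA leq_mul2l; apply/orP; right; lia.
Qed.

End counting.

(** * The two-sample model *)

Section model.
Set Implicit Arguments.
Unset Strict Implicit.
Context {d : measure_display} {T : measurableType d} {R : realType}.
Context (P : probability T R) (p : nat) (n : 'I_2 -> nat).
Context (mu : 'I_2 -> 'cV[R]_p) (Lam : 'I_2 -> 'M[R]_p).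
Context (y : forall i : 'I_2, 'I_(n i) -> 'I_p -> {RV P >-> R}) (gamma : R).
Hypothesis hyp : model_hyp y gamma.
Hypothesis p0 : (0 < p)%N.
Hypothesis n4 : forall i, (4 <= n i)%N.

(** A block names one vector y_ik, the unit of independence between kernels. *)
Definition block := {i : 'I_2 & 'I_(n i)}.
Definition blk (i : 'I_2) (k : 'I_(n i)) : block := Tagged (fun i => 'I_(n i)) k.
Definition yix (i : 'I_2) (k : 'I_(n i)) (s : 'I_p) : yidx n p :=
  Tagged (fun i => ('I_(n i) * 'I_p)%type) (k, s).
Definition block_of (a : yidx n p) : block := blk (tagged a).1.
(** The degree bound of functions that involve only the vectors in [S] and are affine in each of
    their coordinates; [m * blockdeg S] is then the bound for products of m such functions. *)
Definition blockdeg (S : seq block) (a : yidx n p) : nat := block_of a \in S.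
Definition Y (a : yidx n p) : {RV P >-> R} := @y (tag a) (tagged a).1 (tagged a).2.

Lemma Y_indep : mutual_indep P (fun a => Y a : T -> R).
Proof. by case: hyp. Qed.

(** The model gives moments as extended reals; since y^4 is nonnegative and its integral is the real
    gamma, it is integrable, and so are all lower powers. *)
Lemma Y_intg4 a : intg P (fun w => Y a w ^+ 4).
Proof.
have [_ _ _ _ h4] := hyp.
apply/integrableP; split; first by apply/measurable_EFinP; exact: measurable_funX.
have := h4 (tag a) (tagged a).1 (tagged a).2; rewrite unlock => h.
under eq_integral => w _.
  rewrite /= ger0_norm; last by rewrite exprn_even_ge0.
  over.
by rewrite h ltry.
Qed.

Lemma Y_mean0 a : Ex P (Y a) = 0.
Proof.
have [_ _ h1 _ _] := hyp.
apply: EFin_inj; rewrite -Ex_EFin ?h1//.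
exact: (@intg_pow _ _ _ _ _ Y Y_intg4 a 1).
Qed.

Lemma Y_var1 a : Ex P (fun w => Y a w ^+ 2) = 1.
Proof.
have [_ _ _ h2 _] := hyp.
apply: EFin_inj; rewrite -Ex_EFin ?h2//.
exact: (@intg_pow _ _ _ _ _ Y Y_intg4 a 2).
Qed.

Lemma Y_moment4 a : Ex P (fun w => Y a w ^+ 4) = gamma.
Proof.
have [_ _ _ _ h4] := hyp.
apply: EFin_inj; rewrite -Ex_EFin ?h4//; exact: Y_intg4.
Qed.

Lemma gamma_ge0 : 0 <= gamma.
Proof.
have i0 : (0 < n s1)%N by apply: leq_trans (n4 s1).
rewrite -(Y_moment4 (yix (Ordinal i0) (Ordinal p0))).
by apply: Ex_ge0 => w; rewrite exprn_even_ge0.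
Qed.

Lemma yix_inj (i : 'I_2) (k : 'I_(n i)) : injective (yix k).
Proof. by move=> s t /(congr1 (fun a : yidx n p => (tagged a).2)). Qed.

Lemma yix_neq (i j : 'I_2) (k : 'I_(n i)) (l : 'I_(n j)) s t :
  blk k != blk l -> yix k s != yix l t.
Proof. by apply: contra => /eqP/(congr1 block_of)/eqP. Qed.

Lemma blockdeg_le1 S a : (blockdeg S a <= 1)%N.
Proof. by rewrite /blockdeg; case: (_ \in _). Qed.

Lemma blockdeg_cat S S' a : uniq (S ++ S') ->
  (blockdeg S a + blockdeg S' a <= blockdeg (S ++ S') a)%N.
Proof.
rewrite cat_uniq /blockdeg mem_cat => /and3P[_ /hasPn h _].
have := h (block_of a); case: (_ \in S'); case: (_ \in S) => //= /(_ isT).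
by [].
Qed.

Lemma blockdeg_disj S S' a : (forall b, b \in S -> b \notin S') ->
  (blockdeg S a == 0)%N || (blockdeg S' a == 0)%N.
Proof.
by move=> h; rewrite /blockdeg; case: (boolP (_ \in S)) => [/h/negbTE ->|].
Qed.

Lemma Pol_y (i : 'I_2) (k : 'I_(n i)) s S : blk k \in S -> Pol Y (blockdeg S) (@y i k s).
Proof.
by move=> kS; apply: (@Pol_var _ _ _ P _ Y (blockdeg S) (yix k s)); rewrite /blockdeg kS.
Qed.

Lemma intg_blockpol (S : seq block) m f : (m <= 4)%N ->
  Pol Y (fun a => m * blockdeg S a)%N f -> intg P f.
Proof.
move=> m4; apply: (Pol_intg Y_indep Y_intg4) => a.
by apply: leq_trans m4; rewrite -[leqRHS]muln1 leq_mul2l blockdeg_le1 orbT.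
Qed.

Lemma indep_blockpol (S S' : seq block) m m' f g : (m <= 4)%N -> (m' <= 4)%N ->
  (forall b, b \in S -> b \notin S') ->
  Pol Y (fun a => m * blockdeg S a)%N f -> Pol Y (fun a => m' * blockdeg S' a)%N g ->
  Ex P (fun w => f w * g w) = Ex P f * Ex P g.
Proof.
move=> m4 m'4 SS'; apply: (Pol_indep Y_indep Y_intg4).
- by move=> a; apply: leq_trans m4; rewrite -[leqRHS]muln1 leq_mul2l blockdeg_le1 orbT.
- by move=> a; apply: leq_trans m'4; rewrite -[leqRHS]muln1 leq_mul2l blockdeg_le1 orbT.
- by move=> a; rewrite !muln_eq0; case/orP: (blockdeg_disj a SS') => ->; rewrite !orbT.
Qed.

Lemma Pol_blockdeg1 S f : Pol Y (blockdeg S) f -> Pol Y (fun a => 1 * blockdeg S a)%N f.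
Proof. by apply: Pol_le => a; rewrite mul1n. Qed.

(** * Bilinear forms and the kernels of [Ei] and [Eij] *)

Definition cross (i j : 'I_2) : 'M[R]_p := (Lam i)^T *m Lam j.
Definition trSS (i j : 'I_2) : R := \sum_a \sum_b cross i j a b ^+ 2.

Lemma trSSE i j : trSS i j = \tr ((Lam i *m (Lam i)^T) *m (Lam j *m (Lam j)^T)).
Proof. by rewrite mxtrace_gram2. Qed.

Definition bil (i j : 'I_2) (k : 'I_(n i)) (l : 'I_(n j)) w : R :=
  \sum_a \sum_b cross i j a b * (@y i k a w * @y j l b w).

Lemma Pol_bil (i j : 'I_2) (k : 'I_(n i)) (l : 'I_(n j)) S : blk k != blk l ->
  blk k \in S -> blk l \in S -> Pol Y (blockdeg S) (bil k l).
Proof.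
move=> kl kS lS; apply: Pol_sum => a; apply: Pol_sum => b; apply: PolZ.
apply: (PolM_le (@Pol_y _ _ a [:: blk k] (mem_head _ _)) (@Pol_y _ _ b [:: blk l] (mem_head _ _))) => c.
apply: (leq_trans (blockdeg_cat _ _)); first by rewrite /= inE kl.
rewrite /blockdeg !inE; case: eqP => [->|_]; first by rewrite kS.
by case: eqP => [->|//]; rewrite lS.
Qed.

Lemma bil_moment4 (i j : 'I_2) (k : 'I_(n i)) (l : 'I_(n j)) : blk k != blk l ->
  Ex P (fun w => bil k l w ^+ 4) <= (9 + gamma) ^+ 2 * trSS i j ^+ 2.
Proof.
move=> kl; apply: (@bilinear_form_moment4 _ _ _ _ _ Y gamma Y_indep Y_intg4 Y_mean0 Y_var1
  Y_moment4 gamma_ge0 _ _ (yix k) (yix l)) => [||s t].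
- exact: yix_inj.
- exact: yix_inj.
- exact: yix_neq.
Qed.

Definition kern (i j : 'I_2) (q : ('I_(n i) * 'I_(n i)) * ('I_(n j) * 'I_(n j))) w : R :=
  dotv (Dv mu Lam y q.1.1 q.1.2 w) (Dv mu Lam y q.2.1 q.2.2 w).

Definition blocks (i j : 'I_2) (q : ('I_(n i) * 'I_(n i)) * ('I_(n j) * 'I_(n j))) : seq block :=
  [:: blk q.1.1; blk q.1.2; blk q.2.1; blk q.2.2].

Lemma DvE (i : 'I_2) (k r : 'I_(n i)) w :
  Dv mu Lam y k r w = Lam i *m \col_s (@y i k s w - @y i r s w).
Proof.
rewrite /Dv /xv opprD addrACA subrr add0r -mulmxBr; congr (_ *m _).
by apply/matrixP => s t; rewrite !mxE.
Qed.

Lemma kernE (i j : 'I_2) (q : ('I_(n i) * 'I_(n i)) * ('I_(n j) * 'I_(n j))) w :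
  kern q w = \sum_a \sum_b cross i j a b *
    ((@y i q.1.1 a w - @y i q.1.2 a w) * (@y j q.2.1 b w - @y j q.2.2 b w)).
Proof.
rewrite /kern !DvE dotv_mul2; apply: eq_bigr => a _; apply: eq_bigr => b _.
by rewrite !mxE.
Qed.

(** This expansion serves for the degrees and the fourth moment. The second moment is computed
    exactly from [kernE], where the differences y_ik - y_ir form a single orthogonal family. *)
Lemma kern_bil (i j : 'I_2) (q : ('I_(n i) * 'I_(n i)) * ('I_(n j) * 'I_(n j))) w :
  kern q w = bil q.1.1 q.2.1 w - bil q.1.1 q.2.2 w - bil q.1.2 q.2.1 w + bil q.1.2 q.2.2 w.
Proof.
rewrite kernE /bil -!sumrB -big_split /=; apply: eq_bigr => a _.
rewrite -!sumrB -big_split /=; apply: eq_bigr => b _; ring.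
Qed.

Lemma y_diff_cov (i : 'I_2) (k r : 'I_(n i)) : blk k != blk r -> forall s s',
  Ex P (fun w => (@y i k s w - @y i r s w) * (@y i k s' w - @y i r s' w)) = 2 * (s == s')%:R.
Proof.
move=> kr s s'; have rk : blk r != blk k by rewrite eq_sym.
have Iv a b : intg P (fun w => Y a w * Y b w).
  apply: (Pol_intg Y_indep Y_intg4) (PolM (@Pol_var _ _ _ P _ Y (fun=> 1%N) a isT) (@Pol_var _ _ _ P _ Y (fun=> 1%N) b isT)).
  by [].
have EV := @Ex_var_var _ _ _ P _ Y Y_indep Y_intg4 Y_mean0 Y_var1.
have eqy (m : 'I_(n i)) : (yix m s == yix m s') = (s == s').
  by apply/eqP/eqP => [/yix_inj|->].
have -> : (fun w => (@y i k s w - @y i r s w) * (@y i k s' w - @y i r s' w)) =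
  (fun w => Y (yix k s) w * Y (yix k s') w - Y (yix k s) w * Y (yix r s') w
    - Y (yix r s) w * Y (yix k s') w + Y (yix r s) w * Y (yix r s') w).
  by apply/funext => w; rewrite /Y /=; ring.
rewrite ExD ?ExB//; try by do ![exact: Iv|apply: intgB].
rewrite !EV !eqy (negbTE (yix_neq _ _ kr)) (negbTE (yix_neq _ _ rk)) !subr0.
by ring.
Qed.

Section kernel.
Context (i j : 'I_2) (q : ('I_(n i) * 'I_(n i)) * ('I_(n j) * 'I_(n j))).
Hypothesis uq : uniq (blocks q).

Lemma Pol_kern : Pol Y (blockdeg (blocks q)) (kern q).
Proof.
have -> : kern q = (fun w => bil q.1.1 q.2.1 w - bil q.1.1 q.2.2 w - bil q.1.2 q.2.1 w + bil q.1.2 q.2.2 w).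
  by apply/funext => w; exact: kern_bil.
move: uq; rewrite /= !inE !negb_or => /and4P[/and3P[h1 h2 h3] /andP[h4 h5] h6 _].
by apply: PolD; [apply: PolB; [apply: PolB|]|]; apply: Pol_bil; rewrite ?inE ?eqxx ?orbT.
Qed.

(** The coordinates of each difference are uncorrelated with variance 2. The resulting 2 * 2 is what
    the factor 1/4 in the estimators compensates. *)
Lemma kern_moment2 : Ex P (fun w => kern q w ^+ 2) = 4 * trSS i j.
Proof.
under eq_fun do rewrite kernE.
move: uq; rewrite -[blocks q]/([:: blk q.1.1; blk q.1.2] ++ [:: blk q.2.1; blk q.2.2]) => uqc.
move: uq; rewrite /= !inE !negb_or => /and4P[/and3P[h1 h2 h3] /andP[h4 h5] h6 _].
rewrite (@bilinear_form_moment2 _ _ _ P _ Y Y_indep Y_intg4 _ _ _ _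
  (blockdeg [:: blk q.1.1; blk q.1.2]) (blockdeg [:: blk q.2.1; blk q.2.2]) _ 2 2).
- by rewrite /trSS; ring.
- by move=> a; apply: leq_trans (blockdeg_le1 _ _) _.
- by move=> a; apply: leq_trans (blockdeg_le1 _ _) _.
- move=> a; apply: blockdeg_disj => b; apply: contraTN => bS.
  by move: uqc; rewrite cat_uniq => /and3P[_ /hasPn h _]; exact: h.
- by move=> s; apply: PolB; apply: Pol_y; rewrite !inE eqxx ?orbT.
- by move=> s; apply: PolB; apply: Pol_y; rewrite !inE eqxx ?orbT.
- exact: y_diff_cov.
- exact: y_diff_cov.
Qed.

(** Applying (u + v)^4 <= 8 (u^4 + v^4) twice gives 64 times the sum of four fourth powers, each
    bounded by [bil_moment4], and 64 * 4 = 256. *)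
Lemma kern_moment4 : Ex P (fun w => kern q w ^+ 4) <= 256 * (9 + gamma) ^+ 2 * trSS i j ^+ 2.
Proof.
move: uq; rewrite /= !inE !negb_or => /and4P[/and3P[h1 h2 h3] /andP[h4 h5] h6 _].
have Ib (k : 'I_(n i)) (l : 'I_(n j)) : blk k != blk l -> intg P (fun w => bil k l w ^+ 4).
  move=> kl; apply: (@intg_blockpol [:: blk k; blk l] 4) => //.
  by apply: PolX; apply: Pol_bil; rewrite ?inE ?eqxx ?orbT.
pose f (k : 'I_(n i)) (l : 'I_(n j)) w := 64 * bil k l w ^+ 4 : R.
have If (k : 'I_(n i)) (l : 'I_(n j)) : blk k != blk l -> intg P (f k l).
  by move=> kl; apply: intgZ; exact: Ib.
have Ef (k : 'I_(n i)) (l : 'I_(n j)) : blk k != blk l ->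
    Ex P (f k l) <= 64 * ((9 + gamma) ^+ 2 * trSS i j ^+ 2).
  by move=> kl; rewrite ExZ ?ler_wpM2l ?bil_moment4//; exact: Ib.
apply: (@le_trans _ _ (Ex P (fun w => f q.1.1 q.2.1 w + f q.1.1 q.2.2 w
    + f q.1.2 q.2.1 w + f q.1.2 q.2.2 w))).
  apply: le_Ex.
  - by apply: intg_blockpol (PolX 4 Pol_kern).
  - by do ![apply: intgD]; exact: If.
  - move=> w; rewrite kern_bil /f -!mulrDr.
    have quad (u v : R) : (u + v) ^+ 4 <= 8 * (u ^+ 4 + v ^+ 4).
      have e2 : (u + v) ^+ 2 <= 2 * (u ^+ 2 + v ^+ 2) by have := sqr_ge0 (u - v); nra.
      have e4 : ((u + v) ^+ 2) ^+ 2 <= (2 * (u ^+ 2 + v ^+ 2)) ^+ 2.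
        by rewrite ler_sqr ?nnegrE ?sqr_ge0 ?mulr_ge0 ?addr_ge0 ?sqr_ge0.
      have -> : (u + v) ^+ 4 = ((u + v) ^+ 2) ^+ 2 by ring.
      by have := sqr_ge0 (u ^+ 2 - v ^+ 2); nra.
    set b1 := bil _ _ w; set b2 := bil _ _ w; set b3 := bil _ _ w; set b4 := bil _ _ w.
    have -> : b1 - b2 - b3 + b4 = (b1 - b2) + (b4 - b3) by ring.
    apply: (le_trans (quad _ _)).
    have := quad b1 (- b2); have := quad b4 (- b3).
    have -> : (- b2) ^+ 4 = b2 ^+ 4 by ring.
    have -> : (- b3) ^+ 4 = b3 ^+ 4 by ring.
    lra.
rewrite !ExD; try by do ![apply: intgD|exact: If].
have := Ef _ _ h2; have := Ef _ _ h3; have := Ef _ _ h4; have := Ef _ _ h5.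
lra.
Qed.

Hypothesis tr0 : 0 < trSS i j.

Definition nkern w := (4 * trSS i j)^-1 * kern q w ^+ 2 - 1.

Lemma Pol_nkern : Pol Y (fun a => 2 * blockdeg (blocks q) a)%N nkern.
Proof.
by apply: PolB (Pol_cst _ _ _); apply: PolZ; apply: PolX; exact: Pol_kern.
Qed.

Lemma nkern_mean0 : Ex P nkern = 0.
Proof.
have I2 : intg P (fun w => kern q w ^+ 2) by apply: intg_blockpol (PolX 2 Pol_kern).
rewrite ExB ?ExZ ?Ex_cst//; [|exact: intgZ|exact: intg_cst].
by rewrite kern_moment2 mulVf ?subrr// mulf_neq0// gt_eqF.
Qed.

(** The normalisation divides 256 by 4^2 and cancels [trSS i j ^+ 2], which leaves a bound free of p
    and of the covariances. *)
Lemma nkern_moment2 : Ex P (fun w => nkern w ^+ 2) <= 16 * (9 + gamma) ^+ 2.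
Proof.
have I2 : intg P (fun w => kern q w ^+ 2) by apply: intg_blockpol (PolX 2 Pol_kern).
have I4 : intg P (fun w => kern q w ^+ 4) by apply: intg_blockpol (PolX 4 Pol_kern).
have In : intg P nkern by apply: intg_blockpol Pol_nkern.
(* With X the normalised square, (X - 1)^2 = X^2 - 1 - 2 (X - 1), and the last term has mean 0. *)
have -> : (fun w => nkern w ^+ 2) = (fun w => (16 * trSS i j ^+ 2)^-1 * kern q w ^+ 4
    - 1 - 2 * nkern w).
  by apply/funext => w; rewrite /nkern; field; rewrite gt_eqF.
have I4' := intgZ (16 * trSS i j ^+ 2)^-1 I4.
rewrite !ExB ?ExZ ?Ex_cst//; try by do ![apply: intgB|apply: intgZ|exact: intg_cst|exact: I4'].
rewrite nkern_mean0 mulr0 subr0.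
have t2 : 0 < 16 * trSS i j ^+ 2 by rewrite mulr_gt0// exprn_gt0.
have : (16 * trSS i j ^+ 2)^-1 * Ex P (fun w => kern q w ^+ 4) <= 16 * (9 + gamma) ^+ 2.
  rewrite ler_pdivrMl//; apply: (le_trans kern_moment4); rewrite le_eqVlt; apply/orP; left.
  by apply/eqP; ring.
lra.
Qed.

End kernel.

(** * Shared blocks and the covariances of the normalised statistics *)

(** The default of [nth] is never reached, as there are four blocks and [a < 4]. *)
Definition qcoord (i j : 'I_2) (a : 'I_4) (q : ('I_(n i) * 'I_(n i)) * ('I_(n j) * 'I_(n j))) : block :=
  nth (blk q.1.1) (blocks q) a.

Lemma mem_blocks (i j : 'I_2) (q : ('I_(n i) * 'I_(n i)) * ('I_(n j) * 'I_(n j))) b :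
  b \in blocks q -> exists a, qcoord a q = b.
Proof.
move=> bq; have ib : (index b (blocks q) < 4)%N by rewrite index_mem.
by exists (Ordinal ib); rewrite /qcoord nth_index.
Qed.

Lemma card_fiber_le1 (i : 'I_2) (x : block) : (#|[pred k : 'I_(n i) | blk k == x]| <= 1)%N.
Proof.
apply/card_le1_eqP => k l; rewrite !inE => /eqP <- /eqP/esym kl.
by apply: val_inj; exact: (congr1 (fun b : block => val (tagged b)) (esym kl)).
Qed.

Lemma balanced_fst (A B : finType) (C : eqType) (f : A -> C) (rho : R) :
  (forall x, #|[pred u | f u == x]|%:R <= rho * #|A|%:R) ->
  forall x, #|[pred u : A * B | f u.1 == x]|%:R <= rho * #|{: A * B}|%:R.
Proof.
move=> h x; rewrite (@eq_card _ _ [predX [pred u | f u == x] & B]); last first.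
  by move=> [u v]; rewrite !inE andbT.
rewrite cardX card_prod !natrM mulrA ler_wpM2r//; exact: h.
Qed.

Lemma balanced_snd (A B : finType) (C : eqType) (f : B -> C) (rho : R) :
  (forall x, #|[pred u | f u == x]|%:R <= rho * #|B|%:R) ->
  forall x, #|[pred u : A * B | f u.2 == x]|%:R <= rho * #|{: A * B}|%:R.
Proof.
move=> h x; rewrite (@eq_card _ _ [predX A & [pred u | f u == x]]); last first.
  by move=> [u v]; rewrite !inE.
rewrite cardX card_prod !natrM mulrCA ler_wpM2l//; exact: h.
Qed.

Lemma blk_balanced (i : 'I_2) (rho : R) : (n i)%:R^-1 <= rho ->
  forall x, #|[pred k : 'I_(n i) | blk k == x]|%:R <= rho * #|'I_(n i)|%:R.
Proof.
move=> ri x; apply: (@le_trans _ _ 1).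
  by rewrite (ler_nat R _ 1) card_fiber_le1.
have ni0 : 0 < (n i)%:R :> R by rewrite ltr0n; apply: leq_trans (n4 i).
by rewrite card_ord -ler_pdivrMr// div1r.
Qed.

(** Positions 0 and 1 range over sample i, positions 2 and 3 over sample j, hence the two conditions
    on [rho]. *)
Lemma qcoord_balanced (i j : 'I_2) (rho : R) : (n i)%:R^-1 <= rho -> (n j)%:R^-1 <= rho ->
  forall a x, #|[pred q | @qcoord i j a q == x]|%:R
    <= rho * #|{: ('I_(n i) * 'I_(n i)) * ('I_(n j) * 'I_(n j))}|%:R.
Proof.
move=> ri rj a; case: a => -[|[|[|[|//]]]] ?.
- exact: (@balanced_fst ('I_(n i) * 'I_(n i))%type ('I_(n j) * 'I_(n j))%type block
    (fun u => blk u.1) rho (@balanced_fst 'I_(n i) 'I_(n i) block (@blk i) rho (blk_balanced ri))).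
- exact: (@balanced_fst ('I_(n i) * 'I_(n i))%type ('I_(n j) * 'I_(n j))%type block
    (fun u => blk u.2) rho (@balanced_snd 'I_(n i) 'I_(n i) block (@blk i) rho (blk_balanced ri))).
- exact: (@balanced_snd ('I_(n i) * 'I_(n i))%type ('I_(n j) * 'I_(n j))%type block
    (fun u => blk u.1) rho (@balanced_fst 'I_(n j) 'I_(n j) block (@blk j) rho (blk_balanced rj))).
- exact: (@balanced_snd ('I_(n i) * 'I_(n i))%type ('I_(n j) * 'I_(n j))%type block
    (fun u => blk u.2) rho (@balanced_snd 'I_(n j) 'I_(n j) block (@blk j) rho (blk_balanced rj))).
Qed.

(* The average of the normalised kernels, that is, [E_i / (tr(Sigma_i^2) / p^2) - 1] and
   [E_ij / (tr(Sigma_i Sigma_j) / p^2) - 1] for the two choices of [v]. *)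
Definition nstat (i j : 'I_2) (v : pred (('I_(n i) * 'I_(n i)) * ('I_(n j) * 'I_(n j)))) w : R :=
  #|v|%:R^-1 * \sum_(q | v q) nkern q w.

(** The last clause makes the selected tuples a fixed proportion of all tuples, so that a bound
    counted over all of them passes to the average over the selected ones. *)
Definition admissible (i j : 'I_2) (v : pred (('I_(n i) * 'I_(n i)) * ('I_(n j) * 'I_(n j)))) :=
  [/\ 0 < trSS i j, forall q, v q -> uniq (blocks q) &
   (#|{: ('I_(n i) * 'I_(n i)) * ('I_(n j) * 'I_(n j))}| <= 11 * #|v|)%N].

Lemma admissible_card (i j : 'I_2) v : @admissible i j v -> 0 < #|v|%:R :> R.
Proof.
case=> _ _ h; rewrite ltr0n; case: #|v| h => //; rewrite muln0 leqn0 !card_prod !card_ord.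
by rewrite !muln_eq0 !orbb; have := n4 i; have := n4 j; case: (n i) => //; case: (n j).
Qed.

(** When the tuples share vectors the degrees add up to 2 + 2 = 4, just what the fourth moments
    allow. *)
Lemma nkern_intgM (i j i' j' : 'I_2) q q' : uniq (@blocks i j q) -> uniq (@blocks i' j' q') ->
  intg P (fun w => nkern q w * nkern q' w).
Proof.
move=> uq uq'.
apply: (Pol_intg Y_indep Y_intg4) (PolM (Pol_nkern uq) (Pol_nkern uq')) => a.
by apply: (@leq_add _ _ 2 2); rewrite -[leqRHS]muln1 leq_mul2l blockdeg_le1.
Qed.

Lemma nstat_intg (i j : 'I_2) v : @admissible i j v -> intg P (nstat v).
Proof.
case=> tr0 uv _; apply: intgZ.
under eq_fun do rewrite big_mkcond /=.
apply: intg_sum => q; case: (boolP (v q)) => vq; last exact: intg_cst.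
by apply: intg_blockpol (Pol_nkern (uv _ vq)).
Qed.

Lemma nstat_mean0 (i j : 'I_2) v : @admissible i j v -> Ex P (nstat v) = 0.
Proof.
case=> tr0 uv _.
have In q : intg P (fun w => if v q then nkern q w else 0).
  case: (boolP (v q)) => vq; last exact: intg_cst.
  by apply: intg_blockpol (Pol_nkern (uv _ vq)).
rewrite /nstat; under eq_fun do rewrite big_mkcond /=.
rewrite ExZ ?Ex_sum//; last exact: intg_sum.
rewrite big1 ?mulr0// => q _; case: (boolP (v q)) => vq; last exact: Ex_cst.
exact: nkern_mean0 (uv _ vq) tr0.
Qed.

Lemma nstat_intgM (i j i' j' : 'I_2) v v' : @admissible i j v -> @admissible i' j' v' ->
  intg P (fun w => nstat v w * nstat v' w).
Proof.
move=> [tr0 uv _] [tr0' uv' _]; rewrite /nstat.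
have -> : (fun w => #|v|%:R^-1 * (\sum_(q | v q) nkern q w) *
      (#|v'|%:R^-1 * (\sum_(q | v' q) nkern q w))) =
    (fun w => #|v|%:R^-1 * #|v'|%:R^-1 * \sum_q \sum_q'
       (if v q && v' q' then nkern q w * nkern q' w else 0)).
  apply/funext => w; rewrite mulrACA; congr (_ * _).
  rewrite [X in X * _]big_mkcond [X in _ * X]big_mkcond /= mulr_suml.
  apply: eq_bigr => q _; rewrite mulr_sumr; apply: eq_bigr => q' _.
  by case: (v q); case: (v' q'); rewrite ?mul0r ?mulr0.
apply: intgZ; apply: intg_sum => q; apply: intg_sum => q'.
case: (boolP (v q)) => vq /=; last exact: intg_cst.
case: (boolP (v' q')) => vq'; last exact: intg_cst.
by apply: nkern_intgM; [exact: uv|exact: uv'].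
Qed.

(** The conditions on [rho] concern the first statistic only. In the constant, 256 is 4 * 4 pairs of
    positions times the 16 of [nkern_moment2], and 121 = 11 * 11 comes from the two proportions of
    selected tuples. *)
Lemma nstat_cov (i j i' j' : 'I_2) v v' (rho : R) :
  @admissible i j v -> @admissible i' j' v' ->
  (n i)%:R^-1 <= rho -> (n j)%:R^-1 <= rho ->
  `|Ex P (fun w => nstat v w * nstat v' w)| <= (256 * 121) * (9 + gamma) ^+ 2 * rho.
Proof.
move=> av av' ri rj; have c0 := admissible_card av; have c0' := admissible_card av'.
have := nstat_intgM av av'.
case: (av) => tr0 uv cv; case: (av') => tr0' uv' cv' IM.
have r0 : 0 <= rho by apply: le_trans ri; rewrite invr_ge0.
set q1 := #|{: ('I_(n i) * 'I_(n i)) * ('I_(n j) * 'I_(n j))}|%:R : R.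
set q2 := #|{: ('I_(n i') * 'I_(n i')) * ('I_(n j') * 'I_(n j'))}|%:R : R.
pose S := Ex P (fun w => (\sum_(q | v q) nkern q w) * (\sum_(q | v' q) nkern q w)).
have HS : `|S| <= 4 * 4 * rho * q1 * q2 * (16 * (9 + gamma) ^+ 2).
  apply: (@ustat_cov_bound _ _ _ P _ _ _ _ _ (@qcoord i j) (@qcoord i' j') rho
    (qcoord_balanced ri rj) v v' (fun q => nkern q) (fun q => nkern q)).
  - by move=> q vq; under eq_fun do rewrite expr2; apply: nkern_intgM; exact: uv.
  - by move=> q vq; under eq_fun do rewrite expr2; apply: nkern_intgM; exact: uv'.
  - by move=> q q' vq vq'; apply: nkern_intgM; [exact: uv|exact: uv'].
  - by move=> q vq; exact: nkern_moment2 (uv _ vq) tr0.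
  - by move=> q vq; exact: nkern_moment2 (uv' _ vq) tr0'.
  - move=> q q' vq vq' nt.
    rewrite (@indep_blockpol (blocks q) (blocks q') 2 2)//.
    + by rewrite (nkern_mean0 (uv _ vq) tr0) mul0r.
    + move=> b /mem_blocks[a <-]; apply/negP => /mem_blocks[a' /eqP].
      by rewrite eq_sym (negbTE (nt a a')).
    + exact: Pol_nkern (uv _ vq).
    + exact: Pol_nkern (uv' _ vq').
  - by rewrite mulr_ge0// exprn_even_ge0.
have -> : (fun w => nstat v w * nstat v' w) = (fun w => (#|v|%:R * #|v'|%:R)^-1 *
    ((\sum_(q | v q) nkern q w) * (\sum_(q | v' q) nkern q w))).
  by apply/funext => w; rewrite /nstat mulrACA invfM.
have IS : intg P (fun w => (\sum_(q | v q) nkern q w) * (\sum_(q | v' q) nkern q w)).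
  have := intgZ (#|v|%:R * #|v'|%:R) IM; congr (intg P _); apply/funext => w.
  by rewrite /nstat; field; rewrite !gt_eqF.
rewrite ExZ// normrM -/S [X in X * _]ger0_norm; last by rewrite invr_ge0 mulr_ge0.
rewrite ler_pdivrMl ?mulr_gt0//; apply: (le_trans HS).
have {}cv : q1 <= 11 * #|v|%:R.
  by rewrite -natrM ler_nat.
have {}cv' : q2 <= 11 * #|v'|%:R.
  by rewrite -natrM ler_nat.
have cc := ler_pM (ler0n _ _) (ler0n _ _) cv cv'.
have -> : 4 * 4 * rho * q1 * q2 * (16 * (9 + gamma) ^+ 2) =
   256 * (9 + gamma) ^+ 2 * rho * (q1 * q2) by ring.
have -> : #|v|%:R * #|v'|%:R * ((256 * 121) * (9 + gamma) ^+ 2 * rho) =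
   256 * (9 + gamma) ^+ 2 * rho * (11 * #|v|%:R * (11 * #|v'|%:R)) by ring.
by apply: ler_wpM2l cc; apply: mulr_ge0 => //; apply: mulr_ge0 => //; exact: sqr_ge0.
Qed.

Lemma nstatE (i j : 'I_2) v w : @admissible i j v ->
  1 + nstat v w = (4 * trSS i j * #|v|%:R)^-1 * \sum_(q | v q) kern q w ^+ 2.
Proof.
move=> av; have c0 := admissible_card av; case: av => tr0 _ _.
rewrite /nstat /nkern sumrB -mulr_sumr sumr_const.
by field; rewrite !gt_eqF.
Qed.

Lemma blk_inj (i : 'I_2) : injective (@blk i).
Proof. by move=> k l /(congr1 (fun b : block => val (tagged b)))/val_inj. Qed.

Lemma admissible_distinct4 (i : 'I_2) : 0 < trSS i i -> admissible (i := i) (@distinct4 (n i)).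
Proof.
move=> tr0; split=> //; last exact: card_distinct4_ge.
move=> q; rewrite -[blocks q]/(map (@blk i) [:: q.1.1; q.1.2; q.2.1; q.2.2]).
by rewrite map_inj_uniq//; exact: blk_inj.
Qed.

Lemma blk_neq (i j : 'I_2) (k : 'I_(n i)) (l : 'I_(n j)) : i != j -> blk k != blk l.
Proof. by apply: contra => /eqP/(congr1 (@tag _ _))/eqP. Qed.

Lemma admissible_distinct22 (i j : 'I_2) : i != j -> 0 < trSS i j ->
  admissible (@distinct22 (n i) (n j)).
Proof.
move=> ij tr0; split=> //; last exact: card_distinct22_ge.
move=> q /andP[h1 h2].
have b1 : blk q.1.1 != blk q.1.2 by rewrite (inj_eq (@blk_inj i)).
have b2 : blk q.2.1 != blk q.2.2 by rewrite (inj_eq (@blk_inj j)).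
by rewrite /= !inE !negb_or b1 b2 !blk_neq.
Qed.

Lemma Ei_nstat (i : 'I_2) w : 0 < trSS i i ->
  Ei mu Lam y i w = trSS i i / p%:R ^+ 2 * (1 + nstat (@distinct4 (n i)) w).
Proof.
move=> tr0; have a := admissible_distinct4 tr0; have c0 := admissible_card a.
rewrite nstatE// /Ei /eta1 -card_distinct4.
have -> : \sum_(k < n i) \sum_(r < n i) \sum_(k' < n i) \sum_(r' < n i | uniq [:: k; r; k'; r'])
     (dotv (Dv mu Lam y k r w) (Dv mu Lam y k' r' w)) ^+ 2
   = \sum_(q | @distinct4 (n i) q) kern (i := i) (j := i) q w ^+ 2.
  rewrite [RHS]big_mkcond -sum4E.
  by do 3 apply: eq_bigr => ? _; rewrite big_mkcond.
field; rewrite ?gt_eqF ?ltr0n//; first by rewrite -(ltr0n R).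
Qed.

Lemma Eij_nstat (i j : 'I_2) w : i != j -> 0 < trSS i j ->
  Eij mu Lam y i j w = trSS i j / p%:R ^+ 2 * (1 + nstat (@distinct22 (n i) (n j)) w).
Proof.
move=> ij tr0; have a := admissible_distinct22 ij tr0; have c0 := admissible_card a.
rewrite nstatE// /Eij /eta2.
have -> : (n i * n j * (n i - 1) * (n j - 1) = #|@distinct22 (n i) (n j)|)%N.
  by rewrite card_distinct22; lia.
have -> : \sum_(k < n i) \sum_(r < n i | k != r) \sum_(l < n j) \sum_(s < n j | l != s)
     (dotv (Dv mu Lam y k r w) (Dv mu Lam y l s w)) ^+ 2
   = \sum_(q | @distinct22 (n i) (n j) q) kern (i := i) (j := j) q w ^+ 2.
  rewrite [RHS]big_mkcond -sum4E; apply: eq_bigr => k _; rewrite big_mkcond.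
  apply: eq_bigr => r _; rewrite /distinct22 /=; case: (k != r) => /=.
    by apply: eq_bigr => l _; rewrite big_mkcond.
  by rewrite big1// => l _; rewrite big1.
field; rewrite ?gt_eqF ?ltr0n//; first by rewrite -(ltr0n R).
Qed.

(** * The kernels of [E0] *)

(** The case i = j serves for [Un], the case i != j for [Un12]; the factor 1/p is put back only in
    [Un_stat2] and [Un12_stat2]. *)
Definition kern2 (i j : 'I_2) (q : 'I_(n i) * 'I_(n j)) w : R :=
  dotv (xv mu Lam y q.1 w) (xv mu Lam y q.2 w) - dotv (mu i) (mu j).

(** For two distinct vectors this is the Hoeffding decomposition: one linear form in each vector and
    a degenerate bilinear form. *)
Lemma kern2E (i j : 'I_2) (q : 'I_(n i) * 'I_(n j)) w : kern2 q w =
  \sum_b ((Lam j)^T *m mu i) b 0 * @y j q.2 b w + \sum_a ((Lam i)^T *m mu j) a 0 * @y i q.1 a w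
  + bil q.1 q.2 w.
Proof.
rewrite /kern2 /xv dotvDl !dotvDr dotv_mul2 (dotvC (Lam i *m _) (mu j)) !dotv_mul_l.
have -> : forall a b c e : R, a + b + (c + e) - a = b + c + e by move=> *; ring.
by congr (_ + _ + _); apply: eq_bigr => a _; [..|apply: eq_bigr => b _];
  rewrite /cross; congr (_ * _); rewrite !mxE.
Qed.

(** The second moments of the three terms of [kern2E], added and multiplied by 3 in view of (a + b +
    c)^2 <= 3 (a^2 + b^2 + c^2). *)
Definition kern2_var (i j : 'I_2) : R := 3 * (bform (mu i) (Lam j *m (Lam j)^T) (mu i)
  + bform (mu j) (Lam i *m (Lam i)^T) (mu j) + trSS i j).

Lemma kern2_var_ge0 i j : 0 <= kern2_var i j.
Proof.
rewrite mulr_ge0// !addr_ge0// ?bform_gram; try by apply: sumr_ge0 => ? _; exact: sqr_ge0.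
by apply: sumr_ge0 => ? _; apply: sumr_ge0 => ? _; exact: sqr_ge0.
Qed.

Section kernel2.
Context (i j : 'I_2) (q : 'I_(n i) * 'I_(n j)).
Hypothesis uq : blk q.1 != blk q.2.

Let blocks2 := [:: blk q.1; blk q.2].

Lemma Pol_kern2 : Pol Y (blockdeg blocks2) (kern2 q).
Proof.
have -> : kern2 q = (fun w => \sum_b ((Lam j)^T *m mu i) b 0 * @y j q.2 b w +
    \sum_a ((Lam i)^T *m mu j) a 0 * @y i q.1 a w + bil q.1 q.2 w).
  by apply/funext => w; exact: kern2E.
apply: PolD; last by apply: Pol_bil; rewrite ?inE ?eqxx ?orbT.
by apply: PolD; apply: Pol_sum => a; apply: PolZ; apply: Pol_y; rewrite !inE eqxx ?orbT.
Qed.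

Let lin_l w := \sum_b ((Lam j)^T *m mu i) b 0 * @y j q.2 b w.
Let lin_r w := \sum_a ((Lam i)^T *m mu j) a 0 * @y i q.1 a w.

Let Pol_l : Pol Y (blockdeg blocks2) lin_l.
Proof. by apply: Pol_sum => a; apply: PolZ; apply: Pol_y; rewrite !inE eqxx orbT. Qed.

Let Pol_r : Pol Y (blockdeg blocks2) lin_r.
Proof. by apply: Pol_sum => a; apply: PolZ; apply: Pol_y; rewrite !inE eqxx. Qed.

Let Pol_b : Pol Y (blockdeg blocks2) (bil q.1 q.2).
Proof. by apply: Pol_bil; rewrite ?inE ?eqxx ?orbT. Qed.

Let EV := @Ex_var_var _ _ _ P _ Y Y_indep Y_intg4 Y_mean0 Y_var1.

Lemma kern2_mean0 : Ex P (kern2 q) = 0.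
Proof.
have I1 f : Pol Y (blockdeg blocks2) f -> intg P f.
  by move=> /Pol_blockdeg1; exact: intg_blockpol.
have Iy i' (k : 'I_(n i')) s : intg P (@y i' k s).
  exact: (@intg_pow _ _ _ _ _ Y Y_intg4 (yix k s) 1).
have Ey i' (k : 'I_(n i')) s : Ex P (@y i' k s) = 0 by exact: (Y_mean0 (yix k s)).
have Iyy s t : intg P (fun w => @y i q.1 s w * @y j q.2 t w).
  apply: I1; apply: (PolM_le (@Pol_y _ _ s [:: blk q.1] (mem_head _ _))
    (@Pol_y _ _ t [:: blk q.2] (mem_head _ _))) => a.
  by apply: (@blockdeg_cat [:: blk q.1] [:: blk q.2]); rewrite /= inE uq.
have -> : kern2 q = (fun w => lin_l w + lin_r w + bil q.1 q.2 w).
  by apply/funext => w; exact: kern2E.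
rewrite !ExD; try by do ![exact: I1|apply: intgD].
have -> : Ex P lin_l = 0.
  rewrite Ex_sum => [|b]; last exact: intgZ.
  by rewrite big1// => b _; rewrite ExZ// Ey mulr0.
have -> : Ex P lin_r = 0.
  rewrite Ex_sum => [|b]; last exact: intgZ.
  by rewrite big1// => b _; rewrite ExZ// Ey mulr0.
rewrite Ex_sum => [|a]; last by apply: intg_sum => b; exact: intgZ.
rewrite big1 ?addr0// => a _; rewrite Ex_sum => [|b]; last exact: intgZ.
rewrite big1// => b _; rewrite ExZ//.
by rewrite (EV (yix q.1 a) (yix q.2 b)) (negbTE (yix_neq _ _ uq)) mulr0.
Qed.

Lemma kern2_intg2 : intg P (fun w => kern2 q w ^+ 2).
Proof. by apply: intg_blockpol (PolX 2 Pol_kern2). Qed.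

Lemma kern2_moment2 : Ex P (fun w => kern2 q w ^+ 2) <= kern2_var i j.
Proof.
have I2 f : Pol Y (blockdeg blocks2) f -> intg P (fun w => f w ^+ 2).
  by move=> pf; apply: intg_blockpol (PolX 2 pf).
have cy i' (k : 'I_(n i')) s s' : Ex P (fun w => @y i' k s w * @y i' k s' w) = 1 * (s == s')%:R.
  rewrite (EV (yix k s) (yix k s')) mul1r; congr (_%:R); congr nat_of_bool.
  by apply/eqP/eqP => [/yix_inj|->].
have b2 S a : (blockdeg S a <= 2)%N by apply: leq_trans (blockdeg_le1 _ _) _.
have El : Ex P (fun w => lin_l w ^+ 2) = bform (mu i) (Lam j *m (Lam j)^T) (mu i).
  rewrite bform_gram (@linear_form_moment2 _ _ _ P _ Y Y_indep Y_intg4 _ _ (blockdeg [:: blk q.2]) _ 1) ?mul1r//.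
  by move=> s; apply: Pol_y; rewrite inE.
have Er : Ex P (fun w => lin_r w ^+ 2) = bform (mu j) (Lam i *m (Lam i)^T) (mu j).
  rewrite bform_gram (@linear_form_moment2 _ _ _ P _ Y Y_indep Y_intg4 _ _ (blockdeg [:: blk q.1]) _ 1) ?mul1r//.
  by move=> s; apply: Pol_y; rewrite inE.
have Eb : Ex P (fun w => bil q.1 q.2 w ^+ 2) = trSS i j.
  rewrite (@bilinear_form_moment2 _ _ _ P _ Y Y_indep Y_intg4 _ _ _ _
    (blockdeg [:: blk q.1]) (blockdeg [:: blk q.2]) _ 1 1) ?mulr1 ?mul1r//.
  - by move=> a; apply: blockdeg_disj => b; rewrite !inE => /eqP ->.
  - by move=> s; apply: Pol_y; rewrite inE.
  - by move=> s; apply: Pol_y; rewrite inE.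
rewrite /kern2_var -El -Er -Eb -ExD ?I2// -ExD ?I2//; last by apply: intgD; exact: I2.
rewrite -ExZ; last by do ![apply: intgD|exact: I2].
apply: le_Ex.
- exact: kern2_intg2.
- by apply: intgZ; do ![apply: intgD|exact: I2].
move=> w; rewrite kern2E -/(lin_l w) -/(lin_r w).
have := sqr_ge0 (lin_l w - lin_r w); have := sqr_ge0 (lin_l w - bil q.1 q.2 w).
by have := sqr_ge0 (lin_r w - bil q.1 q.2 w); nra.
Qed.

End kernel2.

Definition stat2 (i j : 'I_2) (v : pred ('I_(n i) * 'I_(n j))) w : R :=
  #|v|%:R^-1 * \sum_(q | v q) kern2 q w.

Definition admissible2 (i j : 'I_2) (v : pred ('I_(n i) * 'I_(n j))) :=
  (forall q, v q -> blk q.1 != blk q.2) /\ (#|{: 'I_(n i) * 'I_(n j)}| <= 2 * #|v|)%N.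

Lemma admissible2_card (i j : 'I_2) v : @admissible2 i j v -> 0 < #|v|%:R :> R.
Proof.
case=> _ h; rewrite ltr0n; case: #|v| h => //; rewrite muln0 leqn0 !card_prod !card_ord.
by rewrite !muln_eq0; have := n4 i; have := n4 j; case: (n i) => //; case: (n j).
Qed.

Lemma stat2_intg (i j : 'I_2) v : @admissible2 i j v -> intg P (stat2 v).
Proof.
case=> uv _; apply: intgZ; under eq_fun do rewrite big_mkcond /=.
apply: intg_sum => q; case: (boolP (v q)) => vq; last exact: intg_cst.
by apply: intg_blockpol (Pol_blockdeg1 (Pol_kern2 (uv _ vq))).
Qed.

Lemma stat2_mean0 (i j : 'I_2) v : @admissible2 i j v -> Ex P (stat2 v) = 0.
Proof.
case=> uv _.
have In q : intg P (fun w => if v q then kern2 q w else 0).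
  case: (boolP (v q)) => vq; last exact: intg_cst.
  by apply: intg_blockpol (Pol_blockdeg1 (Pol_kern2 (uv _ vq))).
rewrite /stat2; under eq_fun do rewrite big_mkcond /=.
rewrite ExZ ?Ex_sum//; last exact: intg_sum.
rewrite big1 ?mulr0// => q _; case: (boolP (v q)) => vq; last exact: Ex_cst.
exact: kern2_mean0 (uv _ vq).
Qed.

Lemma kern2_intgM (i j i' j' : 'I_2) (q : 'I_(n i) * 'I_(n j)) (q' : 'I_(n i') * 'I_(n j')) :
  blk q.1 != blk q.2 -> blk q'.1 != blk q'.2 -> intg P (fun w => kern2 q w * kern2 q' w).
Proof.
move=> uq uq'.
apply: (Pol_intg Y_indep Y_intg4) (PolM (Pol_kern2 uq) (Pol_kern2 uq')) => a.
by apply: leq_trans (leq_add (blockdeg_le1 _ _) (blockdeg_le1 _ _)) _.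
Qed.

Lemma stat2_intgM (i j i' j' : 'I_2) v v' : @admissible2 i j v -> @admissible2 i' j' v' ->
  intg P (fun w => stat2 v w * stat2 v' w).
Proof.
move=> [uv _] [uv' _]; rewrite /stat2.
have -> : (fun w => #|v|%:R^-1 * (\sum_(q | v q) kern2 q w) *
      (#|v'|%:R^-1 * (\sum_(q | v' q) kern2 q w))) =
    (fun w => #|v|%:R^-1 * #|v'|%:R^-1 * \sum_q \sum_q'
       (if v q && v' q' then kern2 q w * kern2 q' w else 0)).
  apply/funext => w; rewrite mulrACA; congr (_ * _).
  rewrite [X in X * _]big_mkcond [X in _ * X]big_mkcond /= mulr_suml.
  apply: eq_bigr => q _; rewrite mulr_sumr; apply: eq_bigr => q' _.
  by case: (v q); case: (v' q'); rewrite ?mul0r ?mulr0.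
apply: intgZ; apply: intg_sum => q; apply: intg_sum => q'.
case: (boolP (v q)) => vq /=; last exact: intg_cst.
case: (boolP (v' q')) => vq'; last exact: intg_cst.
by apply: kern2_intgM; [exact: uv|exact: uv'].
Qed.

Definition qcoord2 (i j : 'I_2) (a : 'I_2) (q : 'I_(n i) * 'I_(n j)) : block :=
  nth (blk q.1) [:: blk q.1; blk q.2] a.

Lemma qcoord2_balanced (i j : 'I_2) (rho : R) : (n i)%:R^-1 <= rho -> (n j)%:R^-1 <= rho ->
  forall a x, #|[pred q | @qcoord2 i j a q == x]|%:R <= rho * #|{: 'I_(n i) * 'I_(n j)}|%:R.
Proof.
move=> ri rj a; case: a => -[|[|//]] ?.
- exact: (@balanced_fst 'I_(n i) 'I_(n j) block (@blk i) rho (blk_balanced ri)).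
- exact: (@balanced_snd 'I_(n i) 'I_(n j) block (@blk j) rho (blk_balanced rj)).
Qed.

(** The constant 16 is 2 * 2 pairs of positions times 2 * 2 for the proportion of selected pairs. *)
Lemma stat2_var (i j : 'I_2) v (rho : R) : @admissible2 i j v ->
  (n i)%:R^-1 <= rho -> (n j)%:R^-1 <= rho ->
  Ex P (fun w => stat2 v w ^+ 2) <= 16 * kern2_var i j * rho.
Proof.
move=> av ri rj; have c0 := admissible2_card av; have IM := stat2_intgM av av.
case: (av) => uv cv.
have r0 : 0 <= rho by apply: le_trans ri; rewrite invr_ge0.
set q1 := #|{: 'I_(n i) * 'I_(n j)}|%:R : R.
pose S := Ex P (fun w => (\sum_(q | v q) kern2 q w) * (\sum_(q | v q) kern2 q w)).
have HS : `|S| <= 2 * 2 * rho * q1 * q1 * kern2_var i j.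
  apply: (@ustat_cov_bound _ _ _ P _ _ _ _ _ (@qcoord2 i j) (@qcoord2 i j) rho
    (qcoord2_balanced ri rj) v v (fun q => kern2 q) (fun q => kern2 q)).
  - by move=> q vq; apply: kern2_intg2; exact: uv.
  - by move=> q vq; apply: kern2_intg2; exact: uv.
  - by move=> q q' vq vq'; apply: kern2_intgM; exact: uv.
  - by move=> q vq; apply: kern2_moment2; exact: uv.
  - by move=> q vq; apply: kern2_moment2; exact: uv.
  - move=> q q' vq vq' nt.
    rewrite (@indep_blockpol [:: blk q.1; blk q.2] [:: blk q'.1; blk q'.2] 1 1)//.
    + by rewrite (kern2_mean0 (uv _ vq)) mul0r.
    + move=> b; rewrite !inE negb_or.
      have := nt (@Ordinal 2 0 isT) (@Ordinal 2 0 isT).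
      have := nt (@Ordinal 2 0 isT) (@Ordinal 2 1 isT).
      have := nt (@Ordinal 2 1 isT) (@Ordinal 2 0 isT).
      have := nt (@Ordinal 2 1 isT) (@Ordinal 2 1 isT).
      rewrite /qcoord2 /= => n11 n10 n01 n00.
      by case/orP => /eqP ->; apply/andP; split.
    + exact: Pol_blockdeg1 (Pol_kern2 (uv _ vq)).
    + exact: Pol_blockdeg1 (Pol_kern2 (uv _ vq')).
  - exact: kern2_var_ge0.
have -> : (fun w => stat2 v w ^+ 2) = (fun w => (#|v|%:R * #|v|%:R)^-1 *
    ((\sum_(q | v q) kern2 q w) * (\sum_(q | v q) kern2 q w))).
  by apply/funext => w; rewrite expr2 /stat2 mulrACA invfM.
have IS : intg P (fun w => (\sum_(q | v q) kern2 q w) * (\sum_(q | v q) kern2 q w)).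
  have := intgZ (#|v|%:R * #|v|%:R) IM; congr (intg P _); apply/funext => w.
  by rewrite /stat2; field; rewrite !gt_eqF.
rewrite ExZ// -/S ler_pdivrMl ?mulr_gt0//; apply: (le_trans (le_trans (ler_norm _) HS)).
have {}cv : q1 <= 2 * #|v|%:R by rewrite -natrM ler_nat.
have cc := ler_pM (ler0n _ _) (ler0n _ _) cv cv.
have -> : 2 * 2 * rho * q1 * q1 * kern2_var i j = 4 * kern2_var i j * rho * (q1 * q1) by ring.
have -> : #|v|%:R * #|v|%:R * (16 * kern2_var i j * rho) =
   4 * kern2_var i j * rho * (2 * #|v|%:R * (2 * #|v|%:R)) by ring.
by apply: ler_wpM2l cc; apply: mulr_ge0 => //; apply: mulr_ge0 => //; exact: kern2_var_ge0.
Qed.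

(** * Mean and variance of [E0] *)

Let v1 : pred ('I_(n s1) * 'I_(n s1)) := @distinct2 (n s1).
Let v2 : pred ('I_(n s2) * 'I_(n s2)) := @distinct2 (n s2).
Let v12 : pred ('I_(n s1) * 'I_(n s2)) := predT.

Lemma admissible2_distinct2 (i : 'I_2) : admissible2 (i := i) (@distinct2 (n i)).
Proof.
split; last exact: card_distinct2_ge.
by move=> q; rewrite (inj_eq (@blk_inj i)).
Qed.

Lemma admissible2_predT : @admissible2 s1 s2 predT.
Proof.
split; first by move=> q _; exact: blk_neq.
by rewrite [X in (_ <= _ * X)%N](eq_card (B := {: 'I_(n s1) * 'I_(n s2)}))// leq_pmull.
Qed.

Lemma stat2E (i j : 'I_2) v w : @admissible2 i j v ->
  dotv (mu i) (mu j) + stat2 v w =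
  #|v|%:R^-1 * \sum_(q | v q) dotv (xv mu Lam y q.1 w) (xv mu Lam y q.2 w).
Proof.
move=> av; have c0 := admissible2_card av.
rewrite /stat2 /kern2 sumrB sumr_const.
by field; rewrite !gt_eqF.
Qed.

Lemma Un_stat2 (i : 'I_2) w :
  Un mu Lam y i w = p%:R^-1 * (dotv (mu i) (mu i) + stat2 (@distinct2 (n i)) w).
Proof.
have a := admissible2_distinct2 i.
rewrite stat2E// /Un card_distinct2.
have -> : (n i)%:R - 1 = (n i - 1)%:R :> R by rewrite natrB//; apply: leq_trans (n4 i).
under eq_bigr do rewrite big_mkcond /=.
by rewrite pair_bigA /= [in RHS]big_mkcond natrM !invfM !mulrA.
Qed.

Lemma Un12_stat2 w :
  Un12 mu Lam y w = p%:R^-1 * (dotv (mu s1) (mu s2) + stat2 v12 w).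
Proof.
have a := admissible2_predT; rewrite stat2E// /Un12.
have -> : #|v12| = (n s1 * n s2)%N by rewrite (eq_card (B := {: 'I_(n s1) * 'I_(n s2)}))// card_prod !card_ord.
by rewrite pair_bigA /= natrM -mulrA !invfM -!mulrA.
Qed.

Definition delta : R := dotv (mu s1 - mu s2) (mu s1 - mu s2) / p%:R.

Lemma E0_stat2 w : E0 mu Lam y w = delta + p%:R^-1 * (stat2 v1 w + stat2 v2 w - 2 * stat2 v12 w).
Proof.
rewrite /E0 !Un_stat2 Un12_stat2 /delta dotv_sub; ring.
Qed.

Let a1 := admissible2_distinct2 s1.
Let a2 := admissible2_distinct2 s2.
Let a12 := admissible2_predT.

Lemma E0_intg : intg P (E0 mu Lam y).
Proof.
have -> : E0 mu Lam y = (fun w => delta + p%:R^-1 * (stat2 v1 w + stat2 v2 w - 2 * stat2 v12 w)).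
  by apply/funext => w; exact: E0_stat2.
apply: intgD; first exact: intg_cst.
by apply: intgZ; do ![exact: (stat2_intg a1)|exact: (stat2_intg a2)|exact: (stat2_intg a12)|apply: intgB|apply: intgD|apply: intgZ].
Qed.

Lemma E0_mean : Ex P (E0 mu Lam y) = delta.
Proof.
have -> : E0 mu Lam y = (fun w => delta + p%:R^-1 * (stat2 v1 w + stat2 v2 w - 2 * stat2 v12 w)).
  by apply/funext => w; exact: E0_stat2.
have J1 := stat2_intg a1; have J2 := stat2_intg a2; have J12 := stat2_intg a12.
have JB : intg P (fun w => stat2 v1 w + stat2 v2 w - 2 * stat2 v12 w).
  by apply: intgB; [exact: intgD|exact: intgZ].
rewrite ExD; [|exact: intg_cst|exact: intgZ].
rewrite Ex_cst ExZ// ExB; [|exact: intgD|exact: intgZ].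
rewrite ExD// ExZ// (stat2_mean0 a1) (stat2_mean0 a2) (stat2_mean0 a12).
by ring.
Qed.

Let E0c w := E0 mu Lam y w - delta.

Lemma E0_intg2 : intg P (fun w => E0c w * E0c w).
Proof.
have -> : (fun w => E0c w * E0c w) = (fun w => p%:R^-1 ^+ 2 *
   (stat2 v1 w * stat2 v1 w + stat2 v2 w * stat2 v2 w + 4 * (stat2 v12 w * stat2 v12 w)
    + 2 * (stat2 v1 w * stat2 v2 w) - 4 * (stat2 v1 w * stat2 v12 w) - 4 * (stat2 v2 w * stat2 v12 w))).
  by apply/funext => w; rewrite /E0c E0_stat2; ring.
have M11 := stat2_intgM a1 a1; have M22 := stat2_intgM a2 a2.
have M33 := stat2_intgM a12 a12; have M12 := stat2_intgM a1 a2.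
have M13 := stat2_intgM a1 a12; have M23 := stat2_intgM a2 a12.
by apply: intgZ; do ![assumption|apply: intgB|apply: intgD|apply: intgZ].
Qed.

(** From (x + z - 2t)^2 <= 3 (x^2 + z^2 + 4t^2), which avoids the covariances of the three averages:
    3 * 16 * (1 + 1 + 4) = 288. *)
Lemma E0_var (V : R) : (forall i j, kern2_var i j <= V) ->
  Ex P (fun w => E0c w * E0c w)
    <= 288 * (V / p%:R ^+ 2) * ((n s1)%:R^-1 + (n s2)%:R^-1).
Proof.
move=> HV; set rho := _ + _.
have r1 : (n s1)%:R^-1 <= rho by rewrite lerDl invr_ge0.
have r2 : (n s2)%:R^-1 <= rho by rewrite lerDr invr_ge0.
have r0 : 0 <= rho by apply: le_trans r1; rewrite invr_ge0.
have I2 i j v (av : @admissible2 i j v) : intg P (fun w => stat2 v w ^+ 2).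
  by under eq_fun do rewrite expr2; exact: stat2_intgM.
have B i j v (av : @admissible2 i j v) : (n i)%:R^-1 <= rho -> (n j)%:R^-1 <= rho ->
    Ex P (fun w => stat2 v w ^+ 2) <= 16 * V * rho.
  move=> ri rj; apply: (le_trans (stat2_var av ri rj)).
  by apply: ler_wpM2r => //; apply: ler_wpM2l.
have J1 := I2 _ _ _ a1; have J2 := I2 _ _ _ a2; have J12 := I2 _ _ _ a12.
apply: (@le_trans _ _ (Ex P (fun w => 3 * p%:R^-1 ^+ 2 *
   (stat2 v1 w ^+ 2 + stat2 v2 w ^+ 2 + 4 * stat2 v12 w ^+ 2)))).
  apply: le_Ex.
  - exact: E0_intg2.
  - by apply: intgZ; do ![assumption|apply: intgD|apply: intgZ].
  - move=> w; rewrite /E0c E0_stat2.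
    set x := stat2 v1 w; set z := stat2 v2 w; set t := stat2 v12 w.
    have -> : (delta + p%:R^-1 * (x + z - 2 * t) - delta) * (delta + p%:R^-1 * (x + z - 2 * t) - delta)
       = p%:R^-1 ^+ 2 * (x + z - 2 * t) ^+ 2 by ring.
    have -> : 3 * p%:R^-1 ^+ 2 * (x ^+ 2 + z ^+ 2 + 4 * t ^+ 2) =
       p%:R^-1 ^+ 2 * (3 * (x ^+ 2 + z ^+ 2 + 4 * t ^+ 2)) by ring.
    apply: ler_wpM2l; first exact: sqr_ge0.
    have := sqr_ge0 (x - z); have := sqr_ge0 (x + 2 * t); have := sqr_ge0 (z + 2 * t).
    nra.
rewrite ExZ ?ExD ?ExZ//; try by do ![assumption|apply: intgD|apply: intgZ].
have -> : 288 * (V / p%:R ^+ 2) * rho = 3 * p%:R^-1 ^+ 2 * (16 * V * rho + 16 * V * rho + 4 * (16 * V * rho)).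
  by rewrite exprVn; ring.
apply: ler_wpM2l; first by rewrite mulr_ge0// sqr_ge0.
have := B _ _ _ a1 r1 r1; have := B _ _ _ a2 r2 r2; have := B _ _ _ a12 r1 r2.
lra.
Qed.

(** * Ratios of the estimators to their targets *)

Hypothesis trSS0 : forall i j, 0 < trSS i j.

Lemma Ei_ratio i w : Ei mu Lam y i w / (trSS i i / p%:R ^+ 2) = 1 + nstat (@distinct4 (n i)) w.
Proof.
have ps : 0 < p%:R :> R by rewrite ltr0n.
by rewrite Ei_nstat//; field; rewrite !gt_eqF.
Qed.

Lemma Eij_ratio i j w : i != j ->
  Eij mu Lam y i j w / (trSS i j / p%:R ^+ 2) = 1 + nstat (@distinct22 (n i) (n j)) w.
Proof.
have ps : 0 < p%:R :> R by rewrite ltr0n.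
by move=> ij; rewrite Eij_nstat//; field; rewrite !gt_eqF.
Qed.

Lemma Ex_1nstat i j v : @admissible i j v ->
  intg P (fun w => 1 + nstat v w) /\ Ex P (fun w => 1 + nstat v w) = 1.
Proof.
move=> av; have I1 := nstat_intg av; split; first by apply: intgD => //; exact: intg_cst.
by rewrite ExD ?Ex_cst ?nstat_mean0 ?addr0//; exact: intg_cst.
Qed.

Lemma near1_nstat i j v rho : @admissible i j v -> (n i)%:R^-1 <= rho -> (n j)%:R^-1 <= rho ->
  near1 P (fun w => 1 + nstat v w) (256 * 121 * (9 + gamma) ^+ 2 * rho).
Proof.
move=> av ri rj; have [I1 E1] := Ex_1nstat av.
have e : (fun w => (1 + nstat v w - 1) * (1 + nstat v w - 1)) = (fun w => nstat v w * nstat v w).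
  by apply/funext => w; rewrite addrAC subrr add0r.
split=> //; rewrite e; first exact: nstat_intgM.
exact: le_trans (ler_norm _) (nstat_cov av av ri rj).
Qed.

Lemma cov_nstat i j i' j' v v' rho : @admissible i j v -> @admissible i' j' v' ->
  (n i)%:R^-1 <= rho -> (n j)%:R^-1 <= rho ->
  (`| covariance P (fun w => (1 + nstat v w)%R) (fun w => (1 + nstat v' w)%R) |
    <= (256 * 121 * (9 + gamma) ^+ 2 * rho)%:E)%E.
Proof.
move=> av av' ri rj; have [I1 E1] := Ex_1nstat av; have [I1' E1'] := Ex_1nstat av'.
have e : (fun w => (1 + nstat v w - 1) * (1 + nstat v' w - 1)) = (fun w => nstat v w * nstat v' w).
  by apply/funext => w; rewrite addrAC subrr add0r addrAC subrr add0r.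
rewrite covariance_Ex// E1 E1' e; last exact: nstat_intgM.
by rewrite lee_fin; exact: nstat_cov.
Qed.

(** The p^2 allowed to the kernel variance cancels against the factor 1/p of [E0], and the lower
    bound [c] on [delta] makes the result uniform in p. *)
Lemma near1_E0 (V c : R) : (forall i j, kern2_var i j <= V * p%:R ^+ 2) -> 0 < c -> c <= delta ->
  near1 P (fun w => E0 mu Lam y w / delta) (288 * V / c ^+ 2 * ((n s1)%:R^-1 + (n s2)%:R^-1)).
Proof.
move=> HV c0 cd; have d0 : 0 < delta by exact: lt_le_trans cd.
have ps : 0 < p%:R :> R by rewrite ltr0n.
have e0 : (fun w => E0 mu Lam y w / delta) = (fun w => delta^-1 * E0 mu Lam y w).
  by apply/funext => w; rewrite mulrC.
have e : (fun w => (E0 mu Lam y w / delta - 1) * (E0 mu Lam y w / delta - 1)) =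
    (fun w => delta^-1 ^+ 2 * (E0c w * E0c w)).
  by apply/funext => w; rewrite /E0c; field; rewrite gt_eqF.
split.
- by rewrite e0; apply: intgZ; exact: E0_intg.
- by rewrite e0 ExZ ?E0_mean ?mulVf ?gt_eqF//; exact: E0_intg.
- by rewrite e; apply: intgZ; exact: E0_intg2.
rewrite e ExZ; last exact: E0_intg2.
have := E0_var HV.
rewrite mulfK ?gt_eqF ?exprn_gt0//; set rho := _ + _ => Hv.
have V0 : 0 <= V.
  by rewrite -(pmulr_lge0 _ (exprn_gt0 2 ps)); exact: le_trans (kern2_var_ge0 s1 s1) (HV _ _).
have r0 : 0 <= rho by rewrite addr_ge0 ?invr_ge0.
apply: (@le_trans _ _ (delta^-1 ^+ 2 * (288 * V * rho))).
  by apply: ler_wpM2l => //; exact: sqr_ge0.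
rewrite mulrC mulrAC; apply: ler_wpM2r => //; apply: ler_wpM2l; first by rewrite mulr_ge0.
by rewrite -exprVn ler_sqr ?nnegrE ?invr_ge0 ?(ltW c0) ?(ltW d0)// lef_pV2.
Qed.

End model.

(** * Uniform bounds and consistency *)

Section asymptotics.
Set Implicit Arguments.
Unset Strict Implicit.

(** The finitely many values before the threshold are absorbed into the constant; the bounds to be
    proved hold for every p > 0, not only eventually. *)
Lemma bigO1_bound (R : realType) (f : nat -> R) :
  bigO1 f -> exists C : R, 0 <= C /\ forall p, `|f p| <= C.
Proof.
move=> [C [m h]]; exists (`|C| + \sum_(k < m) `|f k|); split.
  by rewrite addr_ge0// sumr_ge0.
move=> p; have [mp|pm] := leqP m p.
  apply: (le_trans (h p mp)); apply: (le_trans (ler_norm C)).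
  by rewrite lerDl sumr_ge0.
rewrite (bigD1 (Ordinal pm))//= addrCA lerDl addr_ge0// sumr_ge0//.
Qed.

Lemma bigO1_bound_fin (R : realType) (J : finType) (f : J -> nat -> R) :
  (forall j, bigO1 (f j)) -> exists C : R, 0 <= C /\ forall j p, `|f j p| <= C.
Proof.
move=> h; have /choice[C HC] := fun j => bigO1_bound (h j).
exists (\sum_j C j); split; first by apply: sumr_ge0 => j _; case: (HC j).
move=> j p; apply: (le_trans (proj2 (HC j) p)).
by rewrite (bigD1 j)//= lerDl sumr_ge0// => k _; case: (HC k).
Qed.

Lemma ord2_case (i : 'I_2) : i = s1 \/ i = s2.
Proof. by case: i => -[|[|//]] h; [left|right]; apply: val_inj. Qed.

Context {R : realType} (gamma : R) (mu : 'I_2 -> forall p : nat, 'cV[R]_p).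
Context (Lam : 'I_2 -> forall p : nat, 'M[R]_p).
Hypothesis pd : forall i p, posdef (Sig Lam i p).

Lemma trSS_Sig p i j : trSS (fun i => Lam i p) i j = \tr (Sig Lam i p *m Sig Lam j p).
Proof. exact: trSSE. Qed.

Lemma trSS_gt0 p i j : (0 < p)%N -> 0 < trSS (fun i => Lam i p) i j.
Proof. by move=> p0; rewrite trSSE; apply: posdef_gram2_gt0 => //; exact: pd. Qed.

(** The quadratic forms in the means are O(p), a fortiori O(p^2), and tr(Sigma_i Sigma_j) is at most
    the product of two traces, each O(p). *)
Lemma kern2_var_bound :
  (forall i, bigO1 (fun p => \tr (Sig Lam i p) / p%:R)) ->
  (forall i j k, bigO1 (fun p => bform (mu i p) (Sig Lam k p) (mu j p) / p%:R)) ->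
  exists V : R, 0 <= V /\ forall p i j, (0 < p)%N ->
    kern2_var (fun i => mu i p) (fun i => Lam i p) i j <= V * p%:R ^+ 2.
Proof.
move=> A2 A3.
have [C2 [C20 H2]] := bigO1_bound_fin A2.
have [C3 [C30 H3]] := @bigO1_bound_fin R ('I_2 * 'I_2)%type
  (fun ik p => bform (mu ik.1 p) (Sig Lam ik.2 p) (mu ik.1 p) / p%:R) (fun ik => A3 _ _ _).
exists (3 * (C3 + C3 + C2 * C2)); split; first by rewrite mulr_ge0// !addr_ge0// mulr_ge0.
move=> p i j p0.
have ps : 0 < p%:R :> R by rewrite ltr0n.
have p1 : 1 <= p%:R :> R by rewrite ler1n.
have B i' k : bform (mu i' p) (Sig Lam k p) (mu i' p) <= C3 * p%:R ^+ 2.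
  have := le_trans (ler_norm _) (H3 (i', k) p); rewrite /= ler_pdivrMr// => h.
  by apply: (le_trans h); rewrite ler_wpM2l// expr2 ler_peMl// ltW.
have Tr i' : \tr (Sig Lam i' p) <= C2 * p%:R.
  by have := le_trans (ler_norm _) (H2 i' p); rewrite ler_pdivrMr.
have Tr0 i' : 0 <= \tr (Sig Lam i' p).
  rewrite /Sig mxtrace_gram; apply: sumr_ge0 => ? _; apply: sumr_ge0 => ? _; exact: sqr_ge0.
have TT : trSS (fun i => Lam i p) i j <= C2 * C2 * p%:R ^+ 2.
  rewrite trSSE; apply: (le_trans (mxtrace_gram2_le _ _)).
  have := ler_pM (Tr0 i) (Tr0 j) (Tr i) (Tr j).
  by rewrite mulrACA -expr2.
rewrite /kern2_var; have := B i j; have := B j i; rewrite /Sig; move: TT; lra.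
Qed.

(** The common source of the variance bounds and of consistency. [C] is chosen before p, the sample
    sizes and the probability space; it adds the constant of [E0], which involves c and Assumptions
    2 and 3, to that of [Ei] and [Eij], which involves gamma only. *)
Lemma ratio_bounds :
  (forall i, bigO1 (fun p => \tr (Sig Lam i p) / p%:R)) ->
  (forall i j k, bigO1 (fun p => bform (mu i p) (Sig Lam k p) (mu j p) / p%:R)) ->
  (exists c : R, 0 < c /\ forall p : nat, (0 < p)%N ->
       c <= dotv (mu s1 p - mu s2 p) (mu s1 p - mu s2 p) / p%:R) ->
  exists C : R, 0 <= C /\
    forall (p : nat) (n : 'I_2 -> nat), (0 < p)%N -> (forall i, (4 <= n i)%N) ->
    forall d (T : measurableType d) (P : probability T R)
      (y : forall i : 'I_2, 'I_(n i) -> 'I_p -> {RV P >-> R}),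
    model_hyp y gamma ->
    let m := fun i => mu i p in let L := fun i => Lam i p in
    let ri := fun i w => Ei m L y i w / (\tr (Sig Lam i p ^+ 2) / p%:R ^+ 2) in
    let rij := fun i j w => Eij m L y i j w / (\tr (Sig Lam i p *m Sig Lam j p) / p%:R ^+ 2) in
    forall i j : 'I_2, i != j ->
    [/\ near1 P (fun w => E0 m L y w / (dotv (mu s1 p - mu s2 p) (mu s1 p - mu s2 p) / p%:R))
          (C * ((n i)%:R^-1 + (n j)%:R^-1)),
        near1 P (ri i) (C * (n i)%:R^-1),
        near1 P (rij i j) (C * ((n i)%:R^-1 + (n j)%:R^-1)) &
        (`| covariance P (ri i) (rij i j) | <= (C * (n i)%:R^-1)%:E)%E].
Proof.
move=> A2 A3 [c [c0 Hc]]; have [V [V0 HV]] := kern2_var_bound A2 A3.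
pose C1 := 288 * V / c ^+ 2; pose C2 := 256 * 121 * (9 + gamma) ^+ 2.
have C10 : 0 <= C1 by apply: divr_ge0; [exact: mulr_ge0|exact: sqr_ge0].
have C20 : 0 <= C2 by apply: mulr_ge0 => //; exact: sqr_ge0.
exists (C1 + C2); split; first exact: addr_ge0.
move=> p n p0 n4 d T P y hy m L ri rij i j ij.
have tr0 i' j' : 0 < trSS L i' j' by exact: trSS_gt0.
have riE i' : ri i' = (fun w => 1 + nstat m L y (@distinct4 (n i')) w).
  apply/funext => w; rewrite /ri expr2.
  by rewrite -(Ei_ratio m y p0 n4 tr0) trSS_Sig.
have rijE : rij i j = (fun w => 1 + nstat m L y (@distinct22 (n i) (n j)) w).
  apply/funext => w; rewrite /rij.
  by rewrite -(Eij_ratio m y p0 n4 tr0)// trSS_Sig.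
have a4 := admissible_distinct4 n4 (tr0 i i).
have a22 := admissible_distinct22 n4 ij (tr0 i j).
have ninv i' : 0 <= (n i')%:R^-1 :> R by rewrite invr_ge0.
have near1_le (f : T -> R) (B B' : R) : near1 P f B -> B <= B' -> near1 P f B'.
  by move=> [? ? ? h] BB'; split=> //; exact: le_trans BB'.
split.
- have -> : (n i)%:R^-1 + (n j)%:R^-1 = (n s1)%:R^-1 + (n s2)%:R^-1 :> R.
    move: ij; have [->|->] := ord2_case i; have [->|->] := ord2_case j => //.
    by rewrite addrC.
  apply: (near1_le _ _ _ (near1_E0 hy p0 n4 (fun i j => HV p i j p0) c0 (Hc p p0))).
  by apply: ler_wpM2r; rewrite ?addr_ge0// lerDl.
- rewrite riE; apply: (near1_le _ _ _ (near1_nstat m hy p0 n4 a4 (lexx _) (lexx _))).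
  by apply: ler_wpM2r => //; rewrite lerDr.
- rewrite rijE.
  have hi : (n i)%:R^-1 <= (n i)%:R^-1 + (n j)%:R^-1 :> R by rewrite lerDl.
  have hj : (n j)%:R^-1 <= (n i)%:R^-1 + (n j)%:R^-1 :> R by rewrite lerDr.
  apply: (near1_le _ _ _ (near1_nstat m hy p0 n4 a22 hi hj)).
  by apply: ler_wpM2r; rewrite ?addr_ge0// lerDr.
- rewrite riE rijE; apply: (le_trans (cov_nstat m hy p0 n4 a4 a22 (lexx _) (lexx _))).
  by rewrite lee_fin; apply: ler_wpM2r => //; rewrite lerDr.
Qed.

End asymptotics.

Theorem theorem2p2 (R : realType) (gamma : R)
    (mu : 'I_2 -> forall p : nat, 'cV[R]_p)
    (Lam : 'I_2 -> forall p : nat, 'M[R]_p) :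
  (* Sigma_i positive definite *)
  (forall i p, posdef (Sig Lam i p)) ->
  (* Assumption 2 *)
  (forall i, bigO1 (fun p => \tr (Sig Lam i p) / p%:R)) ->
  (* Assumption 3 *)
  (forall i j k, bigO1 (fun p => bform (mu i p) (Sig Lam k p) (mu j p) / p%:R)) ->
  (* Assumption 4 *)
  (forall (i j : 'I_2) (a b : nat), (0 < a)%N -> (0 < b)%N -> (a + b <= 4)%N ->
     (fun p : nat => \tr (hadamard (Sig Lam i p ^+ a) (Sig Lam j p ^+ b))
               / \tr (tensmx (Sig Lam i p ^+ a) (Sig Lam j p ^+ b))) @ \oo --> (0 : R)) ->
  (* unbiasedness *)
  (forall (p : nat) (n : 'I_2 -> nat), (0 < p)%N -> (forall i, (4 <= n i)%N) ->
   forall d (T : measurableType d) (P : probability T R)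
     (y : forall i : 'I_2, 'I_(n i) -> 'I_p -> {RV P >-> R}),
   model_hyp y gamma ->
   [/\ ('E_P[E0 (fun i => mu i p) (fun i => Lam i p) y]
          = (dotv (mu s1 p - mu s2 p) (mu s1 p - mu s2 p) / p%:R)%R%:E)%E,
       (forall i, ('E_P[Ei (fun i => mu i p) (fun i => Lam i p) y i]
          = (\tr (Sig Lam i p ^+ 2) / p%:R ^+ 2)%R%:E)%E) &
       (forall i j, i != j -> ('E_P[Eij (fun i => mu i p) (fun i => Lam i p) y i j]
          = (\tr (Sig Lam s1 p *m Sig Lam s2 p) / p%:R ^+ 2)%R%:E)%E)])
  /\
  (* if ||mu1 - mu2||^2/p is bounded away from 0: variance bounds (uniformly
     in p) and consistency *)
  ((exists c : R, 0 < c /\ forall p : nat, (0 < p)%N ->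
       c <= dotv (mu s1 p - mu s2 p) (mu s1 p - mu s2 p) / p%:R) ->
   (exists C : R,
     forall (p : nat) (n : 'I_2 -> nat), (0 < p)%N -> (forall i, (4 <= n i)%N) ->
     forall d (T : measurableType d) (P : probability T R)
       (y : forall i : 'I_2, 'I_(n i) -> 'I_p -> {RV P >-> R}),
     model_hyp y gamma ->
     let delta := dotv (mu s1 p - mu s2 p) (mu s1 p - mu s2 p) / p%:R in
     let r0 := fun w => E0 (fun i => mu i p) (fun i => Lam i p) y w / delta in
     let ri := fun i w => Ei (fun i => mu i p) (fun i => Lam i p) y i w
                           / (\tr (Sig Lam i p ^+ 2) / p%:R ^+ 2) in
     let rij := fun i j w => Eij (fun i => mu i p) (fun i => Lam i p) y i j w
                           / (\tr (Sig Lam i p *m Sig Lam j p) / p%:R ^+ 2) in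
     forall i j : 'I_2, i != j ->
     [/\ ('V_P[r0] <= (C * ((n i)%:R^-1 + (n j)%:R^-1))%R%:E)%E,
         ('V_P[ri i] <= (C * (n i)%:R^-1)%R%:E)%E,
         ('V_P[rij i j] <= (C * ((n i)%:R^-1 + (n j)%:R^-1))%R%:E)%E &
         (`| covariance P (ri i) (rij i j) | <= (C * (n i)%:R^-1)%R%:E)%E])
   /\
   (forall eps eta : R, 0 < eps -> 0 < eta ->
     exists N : nat,
     forall (p : nat) (n : 'I_2 -> nat), (0 < p)%N -> (forall i, (4 <= n i)%N) ->
     (forall i, (N <= n i)%N) ->
     forall d (T : measurableType d) (P : probability T R)
       (y : forall i : 'I_2, 'I_(n i) -> 'I_p -> {RV P >-> R}),
     model_hyp y gamma ->
     let delta := dotv (mu s1 p - mu s2 p) (mu s1 p - mu s2 p) / p%:R in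
     let r0 := fun w => E0 (fun i => mu i p) (fun i => Lam i p) y w / delta in
     let ri := fun i w => Ei (fun i => mu i p) (fun i => Lam i p) y i w
                           / (\tr (Sig Lam i p ^+ 2) / p%:R ^+ 2) in
     let rij := fun i j w => Eij (fun i => mu i p) (fun i => Lam i p) y i j w
                           / (\tr (Sig Lam i p *m Sig Lam j p) / p%:R ^+ 2) in
     (P [set w | (eps < `|r0 w - 1|)%R] <= eta%R%:E)%E /\
     forall i j : 'I_2, i != j ->
       (P [set w | (eps < `|ri i w - 1|)%R] <= eta%R%:E)%E /\
       (P [set w | (eps < `|rij i j w - 1|)%R] <= eta%R%:E)%E)).
Proof.
move=> pd A2 A3 _; split.
  move=> p n p0 n4 d T P y hy.
  pose m := fun i => mu i p; pose L := fun i => Lam i p.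
  have tr0 i j : 0 < trSS L i j by exact: trSS_gt0.
  split.
  - by rewrite (Ex_EFin (E0_intg m L hy n4)) (E0_mean m L hy n4).
  - move=> i; have a4 := admissible_distinct4 n4 (tr0 i i).
    have [I1 E1] := Ex_1nstat m hy a4.
    have -> : Ei m L y i = (fun w => trSS L i i / p%:R ^+ 2 * (1 + nstat m L y (@distinct4 (n i)) w)).
      by apply/funext => w; rewrite (Ei_nstat m y p0 n4).
    by rewrite Ex_EFin ?ExZ ?E1 ?mulr1 ?trSS_Sig// ; exact: intgZ.
  - move=> i j ij; have a22 := admissible_distinct22 n4 ij (tr0 i j).
    have [I1 E1] := Ex_1nstat m hy a22.
    have -> : Eij m L y i j = (fun w => trSS L i j / p%:R ^+ 2 *
        (1 + nstat m L y (@distinct22 (n i) (n j)) w)).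
      by apply/funext => w; rewrite (Eij_nstat m y p0 n4).
    rewrite Ex_EFin ?ExZ ?E1 ?mulr1 ?trSS_Sig//; last exact: intgZ.
    (* The target has the samples in the order 1, 2; the symmetry of tr(AB) covers the other
       order. *)
    move: ij; have [->|->] := ord2_case i; have [->|->] := ord2_case j => //.
    by rewrite mxtrace_mulC.
move=> Hc; have [C [C0 HC]] := ratio_bounds gamma pd A2 A3 Hc; split.
  exists C => p n p0 n4 d T P y hy delta r0 ri rij i j ij.
  have [h0 hi hij hc] := HC p n p0 n4 d T P y hy i j ij.
  by split; [exact: near1_var h0|exact: near1_var hi|exact: near1_var hij|exact: hc].
move=> eps eta e0 t0.
(* If every n_i exceeds x, the Chebyshev bound is at most C (2 / x) / eps^2 = eta C / (C + 1) <=
   eta; taking C + 1 keeps x positive when C = 0. The threshold depends on [C], [eps] and [eta] but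
   not on p. *)
pose x := 2 * (C + 1) / (eps ^+ 2 * eta).
have et0 : 0 < eps ^+ 2 * eta by rewrite mulr_gt0// exprn_gt0.
have x0 : 0 < x by rewrite divr_gt0// mulr_gt0// ltr_wpDl.
exists (Num.bound x) => p n p0 n4 nN d T P y hy delta r0 ri rij.
have ninv i : (n i)%:R^-1 <= x^-1.
  have xn : x < (n i)%:R.
    by apply: (lt_le_trans (archi_boundP (ltW x0))); rewrite ler_nat.
  by rewrite lef_pV2 ?posrE// ?ltW//; exact: lt_trans xn.
have small (B : R) : B <= 2 * x^-1 -> C * B / eps ^+ 2 <= eta.
  move=> Bx; rewrite ler_pdivrMr ?exprn_gt0// mulrC [leRHS]mulrC.
  apply: (@le_trans _ _ (2 * x^-1 * C)); first exact: ler_wpM2r.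
  have -> : 2 * x^-1 * C = eps ^+ 2 * eta * (C / (C + 1)).
    by rewrite /x; field; rewrite !gt_eqF// ltr_wpDl.
  by rewrite ler_piMr ?(ltW et0)// ler_pdivrMr ?ltr_wpDl// mul1r lerDl.
have small2 i j : C * ((n i)%:R^-1 + (n j)%:R^-1) / eps ^+ 2 <= eta.
  by apply: small; rewrite mulr_natl mulr2n lerD.
have small1 i : C * (n i)%:R^-1 / eps ^+ 2 <= eta.
  by apply: small; apply: (le_trans (ninv i)); rewrite ler_peMl ?invr_ge0 ?(ltW x0)// ler1n.
split.
  have s12 : s1 != s2 by [].
  have [h0 _ _ _] := HC p n p0 n4 d T P y hy s1 s2 s12.
  by apply: (le_trans (near1_cvg e0 h0)); rewrite lee_fin.
move=> i j ij; have [_ hi hij _] := HC p n p0 n4 d T P y hy i j ij; split.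
  by apply: (le_trans (near1_cvg e0 hi)); rewrite lee_fin.
by apply: (le_trans (near1_cvg e0 hij)); rewrite lee_fin.
Qed.
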